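(* Let $d$ be an integer with $0\leq d<\infty$, and let $$\gamma=\begin{cases}0 & \text{if } d\leq 1,\\ 1 & \text{if } 2\leq d\leq 3,\\ \lceil d/2\rceil & \text{if } d\geq 4.\end{cases}$$ Let $X$ be a normal space of covering dimension $d$. Let $\xi$ be a vector bundle of finite type over $X$, and let $b=\min_{x\in X}\dim\xi_x$. Suppose that $b\geq\gamma+1$. Then $\xi$ has a trivial summand of rank $b-\gamma$; in other words, $\xi$ possesses (continuous) cross-sections $s_1,\dots,s_{b-\gamma}$ such that for all $x\in X$ the family $(s_1(x),\dots,s_{b-\gamma}(x))$ is linearly independent.
   Context: A vector bundle means a locally trivial complex vector bundle (its rank may vary from point to point); $\xi_x$ is the fiber over $x$ and $\dim\xi_x$ its complex dimension. Over a normal space, a vector bundle is of finite type if there is a finite open covering of the base by open subsets on each of which the bundle is trivial. A topological space is normal if any two disjoint closed subsets have disjoint neighborhoods (no Hausdorff assumption). Covering dimension: a space $X$ has dimension at most $d$ if every open covering of $X$ has an open refinement $(V_j)_{j\in J}$ such that each $x\in X$ lies in $V_j$ for at most $d+1$ indices $j$; $\dim X$ is the smallest such $d\in\{0,1,2,\dots\}$ (or $\infty$ if none exists). *)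

(* Defs.v *)
From HB Require Import structures.
From mathcomp Require Import all_boot all_order all_algebra.
From mathcomp Require Import complex.
From mathcomp Require Import all_classical all_reals all_analysis.

Set Implicit Arguments.
Unset Strict Implicit.
Unset Printing Implicit Defensive.

Import Order.TTheory GRing.Theory Num.Theory.
Import numFieldNormedType.Exports.

Local Open Scope classical_set_scope.
Local Open Scope ring_scope.

Section CoveringDimension.
Context (X : topologicalType).

Definition open_covering (I : Type) (U : I -> set X) : Prop :=
  (forall i, open (U i)) /\ \bigcup_i U i = setT.

Definition refines (J I : Type) (V : J -> set X) (U : I -> set X) : Prop :=
  forall j, exists i, V j `<=` U i.

Definition covering_dim_le (d : nat) : Prop :=
  forall (I : Type) (U : I -> set X), open_covering U ->
  exists (J : Type) (V : J -> set X),
    [/\ open_covering V, refines V U &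
        forall x, ([set j | V j x] #<= `I_d.+1)%card].

Definition covering_dim_eq (d : nat) : Prop :=
  covering_dim_le d /\ forall e, covering_dim_le e -> (d <= e)%N.

End CoveringDimension.

(* Vector bundles are developed over an arbitrary scalar field [K] with its
   norm topology; complex bundles are the case K = R[i], R : realType. *)

(* A family of finite-dimensional vector spaces over X together with a topology
   on the disjoint union of its members, with no compatibility required. *)
Record vfamily (K : numFieldType) (X : topologicalType) := VFamily {
  fiber : X -> vectType K ;
  total_topology : Topological {x : X & fiber x}
}.

(* [total_space xi] must not be confused with the bare sigma type, on which the
   library infers the disjoint-union topology when the fibers carry one. *)
Definition total_space (K : numFieldType) (X : topologicalType)
    (xi : vfamily K X) : Type := {x : X & fiber xi x}.

HB.instance Definition _ (K : numFieldType) (X : topologicalType)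
    (xi : vfamily K X) :=
  Topological.copy (total_space xi) (Topological.Pack (total_topology xi)).

Section VectorBundles.
Context (K : numFieldType) (X : topologicalType).
Implicit Types xi eta zeta : vfamily K X.

Definition in_total xi (x : X) (v : fiber xi x) : total_space xi :=
  existT (fun y => fiber xi y : Type) x v.

Definition bundle_proj xi (e : total_space xi) : X := projT1 e.

Definition total_map xi eta (h : forall x, fiber xi x -> fiber eta x)
    (e : total_space xi) : total_space eta :=
  in_total (h (projT1 e) (projT2 e)).

(* [h] and [k] are unconstrained outside U. *)
Definition iso_over (U : set X) xi eta : Prop :=
  exists (h : forall x, {linear fiber xi x -> fiber eta x})
         (k : forall x, {linear fiber eta x -> fiber xi x}),
    [/\ forall x, U x -> cancel (h x) (k x) /\ cancel (k x) (h x),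
        {within @bundle_proj xi @^-1` U, continuous (total_map h)} &
        {within @bundle_proj eta @^-1` U, continuous (total_map k)}].

Definition product_proj (n : nat) (e : {x : X & 'rV[K]_n}) :
    (X * 'rV[K]_n)%type := (projT1 e, projT2 e).

Definition product_family (n : nat) : vfamily K X :=
  @VFamily K X (fun=> 'rV[K]_n)
    (Topological.class (initial_topology (@product_proj n))).

Definition sum_proj xi eta (e : {x : X & (fiber xi x * fiber eta x)%type}) :
    (total_space xi * total_space eta)%type :=
  (in_total (projT2 e).1, in_total (projT2 e).2).

Definition whitney_sum xi eta : vfamily K X :=
  @VFamily K X (fun x => (fiber xi x * fiber eta x)%type)
    (Topological.class (initial_topology (@sum_proj xi eta))).

Definition trivial_over (U : set X) xi : Prop :=
  exists n, iso_over U xi (product_family n).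

End VectorBundles.

Record vbundle (K : numFieldType) (X : topologicalType) := VBundle {
  vbundle_family :> vfamily K X ;
  bundle_proj_continuous : continuous (@bundle_proj K X vbundle_family) ;
  locally_trivial : forall x : X,
    exists2 U : set X, open_nbhs x U & trivial_over U vbundle_family
}.

Section BundleProperties.
Context (K : numFieldType) (X : topologicalType).
Implicit Types xi eta : vbundle K X.

Definition finite_type xi : Prop :=
  exists (m : nat) (U : 'I_m -> set X),
    open_covering U /\ forall i, trivial_over (U i) xi.

Definition rank_at xi (x : X) : nat := \dim {: fiber xi x}.

Definition is_min_rank xi (b : nat) : Prop :=
  (exists x, rank_at xi x = b) /\ forall x, (b <= rank_at xi x)%N.

Definition has_trivial_summand xi (k : nat) : Prop :=
  exists eta, iso_over setT xi (whitney_sum (product_family K X k) eta).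

Definition continuous_section xi (s : forall x, fiber xi x) : Prop :=
  continuous (fun x => in_total (s x)).

Definition has_independent_sections xi (k : nat) : Prop :=
  exists s : 'I_k -> forall x, fiber xi x,
    (forall i, continuous_section (s i)) /\
    forall x, free [seq s i x | i <- enum 'I_k].

End BundleProperties.

Definition gamma_of_dim (d : nat) : nat :=
  if (d <= 1)%N then 0 else if (d <= 3)%N then 1 else uphalf d.

(* Main.v *)
From HB Require Import structures.
Require Import Defs.
From mathcomp Require Import all_boot all_order all_algebra perm.
From mathcomp Require Import finmap complex ring lra zify.
From mathcomp Require Import all_classical all_reals all_analysis.

(* The inequality [d < 2 (gamma + 1)] makes it possible to find the sections one
   at a time. Suppose that [j <= b - gamma - 1] independent sections are given,
   and that the bundle is trivialized over finitely many open sets in such a way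
   that these sections become the first [j] basis vectors. A further independent
   section is one whose remaining [n - j] complex coordinates never vanish
   simultaneously. It is obtained by correcting the zero section over one
   trivializing set after the other; each step amounts to deforming a map into
   R^q, q = 2 (n - j) > d, away from 0 without changing it where it is already
   nonzero. For this the map is approximated, through the nerve of an open
   covering of order at most d + 1, by convex combinations of at most
   d + 1 <= q vectors in general position, which are linearly independent.
   Shearing the trivializations then turns the new section into the next basis
   vector. Once b - gamma sections are found, a partition of unity glues the
   coordinate functionals to a projection onto the trivial subbundle they span,
   and the kernel of this projection is a complementary bundle. *)

Set Implicit Arguments.
Unset Strict Implicit.
Unset Printing Implicit Defensive.
Import Order.TTheory GRing.Theory Num.Theory.
Import numFieldNormedType.Exports.

(** * Continuity *)

Section ContinuityTools.
Local Open Scope classical_set_scope.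
Local Open Scope ring_scope.

Lemma eq_near_continuous (X Y : topologicalType) (f g : X -> Y) (x : X) :
  (\forall y \near x, f y = g y) -> {for x, continuous f} ->
  {for x, continuous g}.
Proof.
move=> fg cf; have fgx := nbhs_singleton fg.
rewrite /prop_for /continuous_at -fgx.
apply: cvg_trans cf; apply: near_eq_cvg.
exact: fg.
Qed.

Lemma eq_continuous_at (X Y : topologicalType) (f g : X -> Y) (x : X) :
  f =1 g -> {for x, continuous f} -> {for x, continuous g}.
Proof. by move=> /funext ->. Qed.

Lemma continuous_sumr (K : numFieldType) (X : topologicalType) (I : Type)
    (r : seq I) (P : pred I) (f : I -> X -> K) (x : X) :
  (forall i, P i -> {for x, continuous (f i)}) ->
  {for x, continuous (fun y => \sum_(i <- r | P i) f i y)}.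
Proof.
move=> cf; elim: r => [|i r IHr].
  apply: (@eq_near_continuous _ _ (fun=> 0)); last exact: cst_continuous.
  by near=> y; rewrite big_nil.
case Pi: (P i); last first.
  by apply: eq_near_continuous IHr; near=> y; rewrite big_cons Pi.
apply: eq_near_continuous (continuousD (cf i Pi) IHr).
by near=> y; rewrite big_cons Pi.
Unshelve. all: by end_near. Qed.

Lemma matrix_continuousP (K : numFieldType) (X : topologicalType) (m n : nat)
    (w : X -> 'M[K]_(m, n)) (x : X) :
  (forall i j, {for x, continuous (fun y => w y i j)}) <->
  {for x, continuous w}.
Proof.
split=> [cw A [P wP PA]|cw i j]; last first.
  apply: (@continuous_comp _ _ _ w (fun M : 'M[K]_(m, n) => M i j)) => //.
  exact: coord_continuous.
have : \forall y \near x, forall i j, P i j (w y i j).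
  have /= := @filter_forall _ 'I_m (fun i y => forall j, P i j (w y i j))
    (nbhs x) _; apply=> i.
  have /= := @filter_forall _ 'I_n (fun j y => P i j (w y i j))
    (nbhs x) _; apply=> j.
  exact: cw (wP i j).
by apply: filterS => y wy; apply: PA => i j; exact: wy.
Qed.

(** Pointwise universal property of an initial topology; the total spaces of products, Whitney sums
    and subfamilies all carry such a topology. *)
Lemma initial_continuous_at (S : choiceType) (T Y : topologicalType)
    (p : S -> T) (f : Y -> initial_topology p) (y : Y) :
  {for y, continuous (p \o f)} -> {for y, continuous f}.
Proof.
move=> cpf B [C [[D oD <-] Dfy DB]].
have : nbhs y (f @^-1` (p @^-1` D)).
  by apply: (cpf D); apply: open_nbhs_nbhs; split.
by apply: filterS => z; exact: DB.
Qed.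

Lemma pair_continuous_at (X Y Z : topologicalType) (f : X -> Y) (g : X -> Z)
    (x : X) : {for x, continuous f} -> {for x, continuous g} ->
  {for x, continuous (fun y => (f y, g y))}.
Proof. exact: cvg_pair. Qed.

Lemma near_open (X : topologicalType) (U : set X) (x : X) :
  open U -> U x -> \forall y \near x, U y.
Proof. by move=> oU Ux; apply: open_nbhs_nbhs. Qed.

Lemma normal_urysohn (R : realType) (X : topologicalType) (A B : set X) :
  normal_space X -> closed A -> closed B -> A `&` B = set0 ->
  exists f : X -> R, [/\ continuous f, forall x, 0 <= f x <= 1,
    forall x, A x -> f x = 0 & forall x, B x -> f x = 1].
Proof.
move=> nX cA cB AB0.
have /(@uniform_separatorP X R)[f [cf f01 fA fB]] :=
  (@normal_separatorP R X).1 nX A B cA cB AB0.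
exists f; split=> // x; first by have /= := f01 _ (imageT f x); rewrite in_itv.
  by move=> Ax; apply: fA; exists x.
by move=> Bx; apply: fB; exists x.
Qed.

End ContinuityTools.

(** * Continuity of matrix operations *)

Section MatrixContinuity.
Local Open Scope classical_set_scope.
Local Open Scope ring_scope.
Context (K : numFieldType) (X : topologicalType).

Lemma mulmx_continuous (m n p : nat) (f : X -> 'M[K]_(m, n))
    (g : X -> 'M[K]_(n, p)) (x : X) :
  {for x, continuous f} -> {for x, continuous g} ->
  {for x, continuous (fun y => f y *m g y)}.
Proof.
move=> /matrix_continuousP cf /matrix_continuousP cg.
apply/matrix_continuousP => i j.
apply: (@eq_continuous_at _ _ (fun y => \sum_k f y i k * g y k j)).
  by move=> y; rewrite mxE.
by apply: continuous_sumr => k _; exact: continuousM (cf i k) (cg k j).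
Qed.

Lemma addmx_continuous (m n : nat) (f g : X -> 'M[K]_(m, n)) (x : X) :
  {for x, continuous f} -> {for x, continuous g} ->
  {for x, continuous (fun y => f y + g y)}.
Proof.
move=> /matrix_continuousP cf /matrix_continuousP cg.
apply/matrix_continuousP => i j.
apply: (@eq_continuous_at _ _ (fun y => f y i j + g y i j)).
  by move=> y; rewrite mxE.
exact: continuousD (cf i j) (cg i j).
Qed.

Lemma submx_continuous (m n : nat) (f g : X -> 'M[K]_(m, n)) (x : X) :
  {for x, continuous f} -> {for x, continuous g} ->
  {for x, continuous (fun y => f y - g y)}.
Proof.
move=> /matrix_continuousP cf /matrix_continuousP cg.
apply/matrix_continuousP => i j.
apply: (@eq_continuous_at _ _ (fun y => f y i j - g y i j)).
  by move=> y; rewrite !mxE.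
exact: continuousB (cf i j) (cg i j).
Qed.

Lemma scalemx_continuous (m n : nat) (a : X -> K) (g : X -> 'M[K]_(m, n))
    (x : X) :
  {for x, continuous a} -> {for x, continuous g} ->
  {for x, continuous (fun y => a y *: g y)}.
Proof.
move=> ca /matrix_continuousP cg; apply/matrix_continuousP => i j.
apply: (@eq_continuous_at _ _ (fun y => a y * g y i j)).
  by move=> y; rewrite mxE.
exact: continuousM ca (cg i j).
Qed.

End MatrixContinuity.

(** * General position *)

Section GeneralPosition.
Local Open Scope ring_scope.

(** Since [V] is invertible, C + X V = (X + C V^-1) V, and the determinant of the first factor is
    the characteristic polynomial of - C V^-1, which is monic. *)
Lemma det_affine_neq0 (F : fieldType) (n : nat) (C V : 'M[F]_n) :
  \det V != 0 -> \det (map_mx polyC C + 'X *: map_mx polyC V) != 0.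
Proof.
move=> dV; have uV : V \in unitmx by rewrite unitmxE unitfE.
have -> : map_mx polyC C + 'X *: map_mx polyC V =
    char_poly_mx (- (C *m invmx V)) *m map_mx polyC V.
  rewrite /char_poly_mx map_mxN opprK mulmxDl mul_scalar_mx -map_mxM.
  by rewrite mulmxKV // addrC.
rewrite det_mulmx mulf_neq0 //; last by rewrite det_map_mx polyC_eq0.
exact: monic_neq0 (char_poly_monic _).
Qed.

Lemma horner_det_affine (F : fieldType) (n : nat) (C V : 'M[F]_n) (t : F) :
  (\det (map_mx polyC C + 'X *: map_mx polyC V)).[t] = \det (C + t *: V).
Proof.
rewrite -horner_evalE -det_map_mx; congr (\det _).
by apply/matrixP => i j; rewrite !mxE /= /horner_eval !hornerE.
Qed.

(** The product of the polynomials has fewer roots than its size, while e/2, e/3, ... supply as many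
    distinct points of the interval as that size. *)
Lemma exists_nonroot (R : realType) (s : seq {poly R}) (e : R) : 0 < e ->
  all (fun p => p != 0) s -> exists2 t, 0 < t < e & all (fun p => ~~ root p t) s.
Proof.
move=> e0 s0; set P := \prod_(p <- s) p.
have P0 : P != 0 by rewrite prodf_seq_neq0; exact: s0.
pose rs := [seq e / i.+2%:R | i <- iota 0 (size P)].
have urs : uniq rs.
  rewrite map_inj_in_uniq ?iota_uniq // => i j _ _ /(mulfI (lt0r_neq0 e0)).
  by move/invr_inj/eqP; rewrite eqr_nat => /eqP [].
have : ~~ all (root P) rs.
  apply/negP => /(max_poly_roots P0)/(_ urs).
  by rewrite size_map size_iota ltnn.
rewrite -has_predC => /hasP[t /mapP[i _ ->] /= nr]; exists (e / i.+2%:R).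
  by rewrite divr_gt0 //= ltr_pdivrMr // ltr_pMr // ltr1n.
by move: nr; rewrite root_bigmul; apply: sub_all => p.
Qed.

(* Moving [c i] along the moment curve point of parameter [i] makes every
   relevant minor a nonzero polynomial in the size [t] of the displacement. *)
Lemma general_position (R : realType) (I L : finType) (c : I -> L -> R)
    (e : R) : 0 < e ->
  exists w : I -> L -> R, (forall i l, `|w i l - c i l| < e) /\
    forall (S : {set I}) (a : I -> R), (#|S| <= #|L|)%N ->
      (forall l, \sum_(i in S) a i * w i l = 0) -> forall i, i \in S -> a i = 0.
Proof.
(* If [L] is empty then so is [S], and [c] itself will do. *)
move=> e0; case: (pickP (mem L)) => [l0 _|L0]; last first.
  exists c; split=> [i l|S a]; first by rewrite subrr normr0.
  by rewrite (eq_card0 L0) leqn0 cards_eq0 => /eqP -> _ i; rewrite inE.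
pose v (i : I) (l : L) : R := (enum_rank i)%:R ^+ index l (enum L).
(* Adding 1 makes the bound positive; a displacement of size t < e / B then moves each coordinate by
   less than [e]. *)
pose B : R := 1 + \sum_i \sum_l `|v i l|.
have B1 : 1 <= B by rewrite lerDl; do 2! apply: sumr_ge0 => ? _.
have vB i l : `|v i l| <= B.
  rewrite /B (bigD1 i) //= (bigD1 l) //= addrCA -addrA lerDl.
  by rewrite !addr_ge0 //; do ?[apply: sumr_ge0 => ? _].
(* The minors use the first [#|S|] coordinates; when [#|S| <= #|L|] the default [l0] is never
   reached. *)
pose l_ (b : nat) := nth l0 (enum L) b.
pose C (S : {set I}) : 'M[R]_#|S| := \matrix_(p, b) c (enum_val p) (l_ b).
pose V (S : {set I}) : 'M[R]_#|S| := \matrix_(p, b) v (enum_val p) (l_ b).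
have dV (S : {set I}) : (#|S| <= #|L|)%N -> \det (V S) != 0.
  move=> SL; rewrite -det_tr.
  have -> : (V S)^T = Vandermonde #|S| (\row_p (enum_rank (enum_val p))%:R).
    apply/matrixP => p b; rewrite !mxE /v /l_ index_uniq ?enum_uniq //.
    by rewrite -cardE (leq_trans (ltn_ord p)).
  rewrite det_Vandermonde; apply/prodf_neq0 => p _; apply/prodf_neq0 => b pb.
  rewrite !mxE subr_eq0 eqr_nat; apply: contraTneq pb => /ord_inj.
  by move=> /enum_rank_inj/enum_val_inj ->; rewrite ltnn.
pose P S : {poly R} := \det (map_mx polyC (C S) + 'X *: map_mx polyC (V S)).
have [||t /andP[t0 tB] /allP nr] := @exists_nonroot R
    [seq P Z | Z : {set I} <- enum {set I} & (#|Z| <= #|L|)%N] (e / B).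
- by rewrite divr_gt0 // (lt_le_trans ltr01).
- apply/allP => p /mapP[Z]; rewrite mem_filter => /andP[ZL _] ->.
  exact/det_affine_neq0/dV.
exists (fun i l => c i l + t * v i l); split=> [i l|S a SL aw i iS].
  rewrite addrC addKr normrM (gtr0_norm t0).
  rewrite ltr_pdivlMr ?(lt_le_trans ltr01) // in tB.
  by apply: le_lt_trans tB; rewrite ler_wpM2l // ltW.
have /nr : P S \in [seq P Z | Z : {set I} <- enum {set I} & (#|Z| <= #|L|)%N].
  by apply: map_f; rewrite mem_filter SL mem_enum.
rewrite /root horner_det_affine => dA.
have uA : C S + t *: V S \in unitmx by rewrite unitmxE unitfE.
have : (\row_p a (enum_val p)) *m (C S + t *: V S) = 0.
  apply/rowP => b; rewrite !mxE -[RHS](aw (l_ b)) [RHS]big_enum_val.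
  by apply: eq_bigr => p _; rewrite !mxE.
move/(congr1 (mulmxr (invmx (C S + t *: V S)))); rewrite /= mulmxK // mul0mx.
by move/rowP/(_ (enum_rank_in iS i)); rewrite !mxE enum_rankK_in.
Qed.

End GeneralPosition.

(** * Approximation by maps without zeros *)

Section PartitionOfUnity.
Local Open Scope classical_set_scope.
Local Open Scope ring_scope.
Context (R : realType) (X : topologicalType) (nX : normal_space X).
Context (I : finType) (U : I -> set X) (covU : open_covering U).

(* The functions are built one index at a time; those indices not yet
   processed still contribute the whole of [U i] to the covering. *)
Let subordinate_positive (r : seq I) :
  exists phi : I -> X -> R, [/\ forall i, continuous (phi i),
    forall i x, 0 <= phi i x, forall i x, ~ U i x -> phi i x = 0 &
    forall x, (exists2 i, i \in r & 0 < phi i x) \/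
              (exists2 i, i \notin r & U i x)].
Proof.
have [oU cU] := covU.
elim: r => [|j r [phi [cphi phi0 phiU phiC]]].
  exists (fun _ _ => 0); split=> // [_ x|x]; first exact: cst_continuous.
  have [i _ Uix] : (\bigcup_i U i) x by rewrite cU.
  by right; exists i.
(* [O] is what the functions of [r] and the sets still unprocessed cover. Since [U j] covers the
   rest, a Urysohn function that is 0 off [U j] and 1 off [O] can be added to [phi j]. *)
pose O := (\bigcup_(i in [set i | i \in r]) [set x | 0 < phi i x]) `|`
  (\bigcup_(i in [set i | i \notin j :: r]) U i).
have oO : open O.
  apply: openU; apply: bigcup_open => i _ //=.
  apply: (@open_comp X R (phi i) [set z | 0 < z]) => [x _|]; first exact: cphi.
  exact: open_gt.
have [|f [cf f01 f0 f1]] := normal_urysohn R nX (open_closedC (oU j))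
    (open_closedC oO).
  rewrite -subset0 => x [nUj /= nO]; apply: nO.
  case: (phiC x) => -[i ir ix]; [left|right]; exists i => //=.
  rewrite inE (negPf ir) orbF; apply/eqP => ij; apply: nUj; by rewrite -ij.
pose psi i := if i == j then (phi j \+ f : X -> R) else phi i.
exists psi; split.
- move=> i; rewrite /psi; case: eqP => _ //; move=> x.
  by apply: continuousD; [exact: cphi|exact: cf].
- move=> i x; rewrite /psi; case: eqP => _ //=.
  by rewrite addr_ge0 //; case/andP: (f01 x).
- move=> i x; rewrite /psi; case: eqP => [->|_] nU /=; last exact: phiU.
  by rewrite phiU // f0 // addr0.
- move=> x; have [Ox|nOx] := pselect (O x); last first.
    left; exists j; first exact: mem_head.
    by rewrite /psi eqxx /= f1 // ltr_wpDl.
  case: Ox => -[i /= ir ix]; [left|by right; exists i].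
  exists i; first by rewrite inE ir orbT.
  rewrite /psi; case: eqP => [ij|//] /=; rewrite -ij ltr_wpDr //.
  by case/andP: (f01 x).
Qed.

(** The functions [phi i] vanish at the points outside [U i], but perhaps not near them. Subtracting
    a small multiple of their sum and truncating at 0 makes them vanish near such points; dividing
    by the new sum normalizes them. *)
Lemma partition_of_unity : exists chi : I -> X -> R,
  [/\ forall i, continuous (chi i), forall i x, 0 <= chi i x,
      forall x, \sum_i chi i x = 1 &
      forall i x, ~ U i x -> \forall y \near x, chi i y = 0].
Proof.
have [phi [cphi phi0 phiU phiC]] := subordinate_positive (enum I).
pose F x := \sum_i phi i x.
have cF : continuous F by move=> x; apply: continuous_sumr => i _; exact: cphi.
have F0 x : 0 < F x.
  case: (phiC x) => -[i +] ix; last by rewrite mem_enum.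
  move=> _; rewrite /F (bigD1 i) //=; apply: ltr_wpDr => //.
  by apply: sumr_ge0 => k _; exact: phi0.
(* With this constant the subtracted terms add up to only half of [F x], so some [psi i x] remains
   positive. *)
pose a : R := (2 * #|I|%:R)^-1.
pose psi i x := Num.max 0 (phi i x - F x * a).
have cpsi i : continuous (psi i).
  move=> x; apply: (@continuous_max R X (fun=> 0)); first exact: cst_continuous.
  apply: continuousB; first exact: cphi.
  by apply: continuousM; [exact: cF|exact: cst_continuous].
have psi0 i x : 0 <= psi i x by rewrite le_max lexx.
pose s x := \sum_i psi i x.
have cs : continuous s by move=> x; apply: continuous_sumr => i _; exact: cpsi.
have s0 x : 0 < s x.
  rewrite lt_neqAle sumr_ge0 ?andbT // eq_sym; apply/eqP => Sx0.
  have /allP psix : all (fun i => psi i x == 0) (enum I).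
    have := Sx0; rewrite /s => /eqP; rewrite psumr_eq0 // => /allP h.
    by apply/allP => i _; have := h i; rewrite mem_index_enum => /(_ isT).
  have : F x <= F x / 2.
    rewrite {1}/F (@le_trans _ _ (\sum_(i : I) F x * a)) //.
      apply: ler_sum => i _; rewrite -subr_le0.
      by rewrite -(eqP (psix i _)) ?mem_enum // le_max lexx orbT.
    rewrite sumr_const -mulrnAr /a.
    have [->|I0] := posnP #|I|; first by rewrite mulr0n mulr0 divr_ge0 // ltW.
    by rewrite -mulr_natl invfM (mulrCA #|I|%:R) mulfV ?mulr1 // pnatr_eq0 -lt0n.
  by rewrite leNgt ltr_pdivrMr // ltr_pMr // ltr1n.
exists (fun i x => psi i x / s x); split.
- move=> i x; apply: continuousM; first exact: cpsi.
  apply: continuousV; first by rewrite gt_eqF.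
  exact: cs.
- by move=> i x; rewrite divr_ge0 // ltW.
- by move=> x; rewrite -mulr_suml -/(s x) divff // gt_eqF.
- move=> i x nU; have I0 : (0 < #|I|)%N by apply/card_gt0P; exists i.
  have a0 : 0 < a by rewrite invr_gt0 mulr_gt0 // ltr0n.
  have c : {for x, continuous (fun y => phi i y - F y * a)}.
    apply: continuousB; first exact: cphi.
    by apply: continuousM; [exact: cF|exact: cst_continuous].
  have : \forall y \near x, phi i y - F y * a < 0.
    apply: (c [set z | z < 0]); apply: open_nbhs_nbhs; split.
      exact: open_lt.
    by rewrite /= phiU // sub0r oppr_lt0 mulr_gt0.
  apply: filterS => y h; rewrite /psi max_l ?mul0r //; exact: ltW.
Qed.

End PartitionOfUnity.

(** * Nonvanishing approximation through the nerve of a covering *)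

Section NonvanishingApproximation.
Local Open Scope classical_set_scope.
Local Open Scope ring_scope.

(** A map [t] with [V j] inside [U (t j)] regroups the refinement over [I], by uniting the [V j]
    with a common image. Distinct indices of [W] at a point come from distinct indices of [V], so
    the order does not grow. *)
Lemma finite_cover_refinement (X : topologicalType) (d : nat) (I : finType)
    (U : I -> set X) : covering_dim_le X d -> open_covering U ->
  exists W : I -> set X, [/\ open_covering W, forall i, W i `<=` U i &
    forall (x : X) (A : {set I}),
      (forall i, i \in A -> W i x) -> (#|A| <= d.+1)%N].
Proof.
move=> dX covU; have [J [V [[oV cV] rV Vd]]] := dX I U covU.
have [t tV] := choice rV.
exists (fun i => \bigcup_(j in [set j | t j = i]) V j); split.
- split=> [i|]; first exact: bigcup_open.
  rewrite -subTset => x _; have [j _ Vjx] : (\bigcup_j V j) x by rewrite cV.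
  by exists (t j) => //; exists j.
- by move=> i x [j /= <-]; exact: tV.
- move=> x A AW; set B := [set` A].
  have BV : (B #<= `I_d.+1)%card.
    apply: card_le_trans (Vd x); apply: card_le_trans (card_image_le t _).
    apply: subset_card_le => i /= /AW [j /= ti Vjx]; by exists j.
  have := geq_card_fset_set BV.
  suff -> : size (finmap.enum_fset (fset_set B)) = #|A| by [].
  rewrite cardE; apply/perm_size/uniq_perm.
  - exact: finmap.fset_uniq.
  - exact: enum_uniq.
  move=> i; rewrite mem_enum -[LHS]/(i \in fset_set B) in_fset_set.
    by apply/idP/idP; rewrite inE.
  by apply/finite_set_leP; exists d.+1.
Qed.

(** The cube [-1, 1]^L is covered by the open cubes of radius [e] around the points of a grid of
    mesh [e]; these are pulled back along [G]. *)
Lemma grid_cover (R : realType) (X : topologicalType) (L : finType)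
    (G : L -> X -> R) (e : R) :
  0 < e -> (forall l, continuous (G l)) -> (forall l x, `|G l x| <= 1) ->
  exists (I : finType) (c : I -> L -> R),
    open_covering (fun i => [set x | forall l, `|G l x - c i l| < e]).
Proof.
move=> e0 cG G1; pose N := (Num.truncn (2 / e)).+1.
exists {ffun L -> 'I_N}, (fun (i : {ffun L -> 'I_N}) l => (i l)%:R * e - 1).
split=> [i|].
  have -> : [set x | forall l, `|G l x - ((i l)%:R * e - 1)| < e] =
     \bigcap_(l in [set` enum L]) [set x | `|G l x - ((i l)%:R * e - 1)| < e].
    apply/seteqP; split=> x /= h l; first by move=> _; exact: h.
    by apply: h; rewrite /= mem_enum.
  rewrite bigcap_seq; apply: big_ind => [|A B|l _]; first exact: openT.
    exact: openI.
  apply: (@open_comp X R (fun x => `|G l x - ((i l)%:R * e - 1)|)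
    [set z | z < e]) => [x _|]; last exact: open_lt.
  by apply: cvg_norm; apply: cvgB; [exact: cG|exact: cvg_cst].
rewrite -subTset => x _.
have Gx l : 0 <= (G l x + 1) / e <= 2 / e.
  have := G1 l x; rewrite ler_norml => /andP[h1 h2].
  apply/andP; split; first by apply: divr_ge0; [lra|exact: ltW].
  by rewrite ler_pM2r ?invr_gt0 //; lra.
(* Each coordinate is rounded down to the grid; the truncation is at most that of 2 / e, hence below
   [N]. *)
exists [ffun l => inord (Num.truncn ((G l x + 1) / e))] => //= l.
have /andP[h0 h2] := Gx l; have /andP[t1 t2] := Num.Theory.truncn_itv h0.
rewrite ffunE inordK ?ltnS ?le_truncn //.
rewrite ler_pdivlMr // in t1; rewrite ltr_pdivrMr // -natr1 in t2.
by rewrite ltr_norml; lra.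
Qed.

(* In general position the values [w i] attached to the at most [d + 1] indices
   with [phi i x > 0] are linearly independent, so that a convex combination of
   them cannot vanish. *)
Lemma nonvanishing_approximation (R : realType) (X : topologicalType) (d : nat)
    (L : finType) (G : L -> X -> R) (e : R) :
  normal_space X -> covering_dim_le X d -> (d < #|L|)%N -> 0 < e ->
  (forall l, continuous (G l)) -> (forall l x, `|G l x| <= 1) ->
  exists H : L -> X -> R, [/\ forall l, continuous (H l),
    forall l x, `|H l x - G l x| < e & forall x, exists l, H l x != 0].
Proof.
move=> nX dX dL e0 cG G1; have e20 : 0 < e / 2 by rewrite divr_gt0.
have [I [c covU]] := grid_cover e20 cG G1.
have [W [covW WU Wd]] := finite_cover_refinement dX covU.
have [phi [cphi phi0 phi1 phiW]] := partition_of_unity R nX covW.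
have {}phiW i x : phi i x != 0 -> W i x.
  by apply: contraNP => /phiW/nbhs_singleton ->.
(* On [W i] the map [G] is within e/2 of [c i], and [w i] is within e/2 of [c i]. *)
have [w [wc wfree]] := general_position c e20.
exists (fun l x => \sum_i phi i x * w i l); split.
- move=> l x; apply: continuous_sumr => i _.
  by apply: continuousM; [exact: cphi|exact: cst_continuous].
- move=> l x; have -> : G l x = \sum_i phi i x * G l x.
    by rewrite -mulr_suml phi1 mul1r.
  rewrite -sumrB; apply: le_lt_trans (ler_norm_sum _ _ _) _.
  (* A strict bound on the weighted sum needs one index of positive weight. *)
  have [i0 i00] : exists i, 0 < phi i x.
    apply/not_existsP => h; have := phi1 x; rewrite big1 => [/esym/eqP|i _].
      by rewrite oner_eq0.
    by apply/eqP; rewrite eq_le phi0 andbT leNgt; apply/negP/h.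
  have -> : e = \sum_i phi i x * e by rewrite -mulr_suml phi1 mul1r.
  have bound i : phi i x != 0 -> `|w i l - G l x| < e.
    move=> /phiW/WU/(_ l) Gc.
    rewrite -(subrKA (c i l)) (splitr e) (le_lt_trans (ler_normD _ _)) //.
    by rewrite ltrD // distrC.
  rewrite (bigD1 i0) //= [ltRHS](bigD1 i0) //= ltr_leD //.
    by rewrite -mulrBr normrM ger0_norm // ltr_pM2l // bound // gt_eqF.
  apply: ler_sum => i _; rewrite -mulrBr normrM ger0_norm //.
  have [->|h] := eqVneq (phi i x) 0; first by rewrite !mul0r.
  by rewrite ler_wpM2l // ltW // bound.
- move=> x; apply/existsP; rewrite -[X in is_true X]negbK negb_exists.
  apply/negP => /forallP Hx.
  pose A := [set i | phi i x != 0]%SET.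
  have AL : (#|A| <= #|L|)%N.
    by apply: leq_trans dL; apply: (Wd x) => i; rewrite inE => /phiW.
  have sumA l : \sum_(i in A) phi i x * w i l = 0.
    move: (Hx l); rewrite negbK => /eqP h; rewrite -[RHS]h.
    rewrite [RHS](bigID (mem A)) /=.
    rewrite [X in _ = _ + X]big1 ?addr0 // => i.
    by rewrite inE negbK => /eqP ->; rewrite mul0r.
  have phiA := wfree A (phi ^~ x) AL sumA.
  have := phi1 x; rewrite big1 => [/esym/eqP|i _]; first by rewrite oner_eq0.
  by apply/eqP/negbNE/negP => h; have := h; rewrite phiA ?eqxx // inE.
Qed.

End NonvanishingApproximation.

(** * Correction of a map away from its zeros *)

Section NonvanishingCorrection.
Local Open Scope classical_set_scope.
Local Open Scope ring_scope.

(* [g / D] has norm 1 on [A]; where its norm exceeds 1/2, the segment towards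
   the approximation [H] avoids 0, and elsewhere [g / D] is replaced by [H]. *)
Lemma nonvanishing_correction (R : realType) (X : topologicalType) (d : nat)
    (L : finType) (U A O : set X) (chi : X -> R) (a : R) (g : L -> X -> R) :
  normal_space X -> covering_dim_le X d -> (d < #|L|)%N ->
  continuous chi -> (forall x, 0 <= chi x) -> 0 < a ->
  (forall x, ~ U x -> \forall y \near x, chi y = 0) ->
  closed A -> open O -> A `<=` O ->
  (forall l x, U x -> {for x, continuous (g l)}) ->
  (forall x, U x -> O x -> exists l, g l x != 0) ->
  exists r : L -> X -> R, [/\ forall l, continuous (r l),
    forall x, ~ U x -> \forall y \near x, forall l, r l y = 0,
    forall l x, A x -> r l x = 0 &
    forall x, U x -> a <= chi x -> exists l, g l x + r l x != 0].
Proof.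
move=> nX dX dL cchi chi0 a0 chiU cA oO AO cg gO.
have L0 : (0 < #|L|)%N by apply: leq_trans dL.
have [|th [cth th01 th0 th1]] := normal_urysohn R nX (open_closedC oO) cA.
  by rewrite -subset0 => x [/= nO /AO].
pose m x := \sum_l `|g l x|.
have m0 x : 0 <= m x by apply: sumr_ge0.
have cm x : U x -> {for x, continuous m}.
  by move=> Ux; apply: continuous_sumr => l _; apply: cvg_norm; exact: cg.
have gm l x : `|g l x| <= m x.
  by rewrite /m (bigD1 l) //= lerDl sumr_ge0.
(* [th] is 1 on [A] and 0 off [O], so [D] is positive on [U] and equals [m] on [A]. *)
pose D x := m x + (1 - th x).
have mD x : m x <= D x by rewrite lerDl subr_ge0; case/andP: (th01 x).
have D0 x : U x -> 0 < D x.
  move=> Ux; have [Ox|nO] := pselect (O x); last first.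
    by rewrite /D th0 // subr0 ltr_wpDl.
  have [l gl] := gO x Ux Ox; apply: lt_le_trans (mD x).
  by apply: lt_le_trans (gm l x); rewrite normr_gt0.
have cD x : U x -> {for x, continuous D}.
  move=> Ux; apply: continuousD; first exact: cm.
  by apply: continuousB; [exact: cst_continuous|exact: cth].
(* The cutoff is 1 where chi >= a and vanishes near every point outside [U], so that [G] below
   extends continuously by 0. *)
pose cc x := Num.min 1 (chi x / a).
have cc01 x : 0 <= cc x <= 1.
  by rewrite le_min ge_min lexx ler01 /= andbT divr_ge0 // ltW.
have ccU x : ~ U x -> \forall y \near x, cc y = 0.
  move=> /chiU; apply: filterS => y cy.
  by rewrite /cc cy mul0r min_r.
have ccc : continuous cc.
  move=> x; apply: (@continuous_min R X (fun=> 1)); first exact: cst_continuous.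
  by apply: continuousM; [exact: cchi|exact: cst_continuous].
pose G l x := cc x * (g l x / D x).
have cG l : continuous (G l).
  move=> x; have [Ux|nU] := pselect (U x).
    apply: continuousM; first exact: ccc.
    apply: continuousM; first exact: cg.
    by apply: continuousV; [rewrite gt_eqF // D0|exact: cD].
  apply: (@eq_near_continuous _ _ (fun=> 0)); last exact: cst_continuous.
  by apply: filterS (ccU x nU) => y cy; rewrite /G cy mul0r.
have G1 l x : `|G l x| <= 1.
  have [Ux|/ccU/nbhs_singleton cx] := pselect (U x); last first.
    by rewrite /G cx mul0r normr0 ler01.
  case/andP: (cc01 x) => c0 c1; rewrite normrM (ger0_norm c0).
  apply: mulr_ile1 => //; rewrite normrM normfV (gtr0_norm (D0 x Ux)).
  by rewrite ler_pdivrMr ?D0 // mul1r (le_trans (gm l x)).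
(* The errors of the [#|L|] coordinates then sum to at most 1/2. *)
have e0 : 0 < (2 * #|L|%:R)^-1 :> R by rewrite invr_gt0 mulr_gt0 // ltr0n.
have [H [cH HG Hn0]] := nonvanishing_approximation nX dX dL e0 cG G1.
have {}HG x : \sum_l `|H l x - G l x| <= 1 / 2.
  apply: (@le_trans _ _ (\sum_(l : L) (2 * #|L|%:R)^-1)).
    by apply: ler_sum => l _; exact: ltW.
  rewrite sumr_const -[leLHS]mulr_natl invfM mulrCA mulfV ?mulr1 ?mul1r //.
  by rewrite pnatr_eq0 -lt0n.
(* [tau] is 0 where m / D = 1, in particular at the points of [A] in [U], and 1 where m / D <=
   1/2. *)
pose tau x := Num.min 1 (2 - 2 * (m x / D x)).
have ctau x : U x -> {for x, continuous tau}.
  move=> Ux; apply: (@continuous_min R X (fun=> 1)).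
    exact: cst_continuous.
  apply: continuousB; first exact: cst_continuous.
  apply: continuousM; first exact: cst_continuous.
  apply: continuousM; first exact: cm.
  by apply: continuousV; [rewrite gt_eqF // D0|exact: cD].
(* At points of [U] where [cc] is 1, adding this to [g] gives [D] times the convex combination of g
   / D and [H] with weights 1 - tau and tau. *)
exists (fun l x => cc x * tau x * (D x * H l x - g l x)); split.
- move=> l x; have [Ux|nU] := pselect (U x).
    apply: (@continuousM _ _ (fun y => cc y * tau y)
      (fun y => D y * H l y - g l y)).
      by apply: continuousM; [exact: ccc|exact: ctau].
    apply: continuousB; last exact: cg.
    by apply: continuousM; [exact: cD|exact: cH].
  apply: (@eq_near_continuous _ _ (fun=> 0)); last exact: cst_continuous.
  by apply: filterS (ccU x nU) => y cy; rewrite cy !mul0r.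
- by move=> x /ccU; apply: filterS => y cy l; rewrite cy !mul0r.
- move=> l x Ax; have [Ux|/ccU/nbhs_singleton cx] := pselect (U x); last first.
    by rewrite cx !mul0r.
  have Dm : D x = m x by rewrite /D th1 // subrr addr0.
  have mx0 : m x != 0 by rewrite -Dm gt_eqF // D0.
  by rewrite /tau Dm divff // mulr1 subrr min_r // mulr0 mul0r.
- move=> x Ux ax; apply/not_existsP => h.
  have {}h l : g l x + cc x * tau x * (D x * H l x - g l x) = 0.
    by apply/eqP/negbNE/negP/h.
  have c1 : cc x = 1 by rewrite /cc min_l // ler_pdivlMr // mul1r.
  have Dx : D x != 0 by rewrite gt_eqF // D0.
  have {}h l : G l x = - (tau x * (H l x - G l x)).
    move: (h l); rewrite /G c1 !mul1r => hl.
    apply: (mulfI Dx); rewrite mulrCA divff // mulr1.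
    have -> : D x * - (tau x * (H l x - g l x / D x)) =
      - (tau x * (D x * H l x - g l x)) by field.
    by apply/eqP; rewrite -subr_eq0 opprK hl.
  (* If m / D <= 1/2 then [tau] is 1 and [H] would vanish; otherwise the norm m / D of [G] would be
     at most the approximation error, hence at most 1/2. *)
  have [ux|ux] := lerP (m x / D x) (1 / 2).
    have [l /eqP] := Hn0 x; apply; move: (h l).
    by rewrite /tau min_l; [lra|lra].
  have : m x / D x <= \sum_l `|H l x - G l x|.
    rewrite /m mulr_suml; apply: ler_sum => l _.
    have -> : `|g l x| / D x = `|G l x|.
      by rewrite /G c1 mul1r normrM normfV (gtr0_norm (D0 x Ux)).
    rewrite {1}h normrN normrM (@ger0_norm _ (tau x)).
      by rewrite ler_piMl // /tau ge_min lexx.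
    rewrite le_min ler01 /= subr_ge0 -[leRHS]mulr1 ler_pM2l //.
    by rewrite ler_pdivrMr ?D0 // mul1r.
  by move/le_trans/(_ (HG x)); rewrite leNgt ux.
Qed.

End NonvanishingCorrection.

(** * Families of vector spaces *)

Section Subfamily.
Local Open Scope classical_set_scope.
Local Open Scope ring_scope.
Context (K : numFieldType) (X : topologicalType) (xi : vfamily K X).
Context (V : forall x, {vspace fiber xi x}).

Definition sub_incl (e : {x : X & subvs_of (V x)}) : total_space xi :=
  in_total (vsval (projT2 e)).

Definition subfamily : vfamily K X :=
  @VFamily K X (fun x => subvs_of (V x))
    (Topological.class (initial_topology sub_incl)).

Lemma sub_incl_continuous :
  continuous (sub_incl : total_space subfamily -> total_space xi).
Proof. exact: initial_continuous. Qed.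

Lemma subfamily_continuous_at (Y : topologicalType)
    (f : Y -> total_space subfamily) (y : Y) :
  {for y, continuous (fun z => sub_incl (f z))} -> {for y, continuous f}.
Proof. exact: initial_continuous_at. Qed.

End Subfamily.

(** * Products and Whitney sums of families *)

Section ProductAndSum.
Local Open Scope classical_set_scope.
Local Open Scope ring_scope.
Context (K : numFieldType) (X : topologicalType).

Lemma product_continuous_at (n : nat) (Y : topologicalType)
    (f : Y -> total_space (product_family K X n)) (y : Y) :
  {for y, continuous (fun z => projT1 (f z))} ->
  {for y, continuous (fun z => projT2 (f z) : 'rV[K]_n)} ->
  {for y, continuous f}.
Proof.
move=> c1 c2; apply: (@initial_continuous_at _ _ _ (@product_proj K X n)).
exact: (pair_continuous_at c1 c2).
Qed.

Lemma product_snd_continuous (n : nat) :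
  continuous (fun e : total_space (product_family K X n) => projT2 e : 'rV[K]_n).
Proof.
move=> e; have c0 : {for e, continuous (snd \o (@product_proj K X n :
    total_space (product_family K X n) -> _))}.
  by apply: continuous_comp; [exact: initial_continuous|exact: cvg_snd].
exact: c0.
Qed.

Lemma product_bundle_proj_continuous (n : nat) :
  continuous (@bundle_proj K X (product_family K X n)).
Proof.
move=> e; have c0 : {for e, continuous (fst \o (@product_proj K X n :
    total_space (product_family K X n) -> _))}.
  by apply: continuous_comp; [exact: initial_continuous|exact: cvg_fst].
exact: c0.
Qed.

Context (xi eta : vfamily K X).

Lemma whitney_continuous_at (Y : topologicalType)
    (f : Y -> total_space (whitney_sum xi eta)) (y : Y) :
  {for y, continuous (fun z => in_total (projT2 (f z)).1 : total_space xi)} ->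
  {for y, continuous (fun z => in_total (projT2 (f z)).2 : total_space eta)} ->
  {for y, continuous f}.
Proof.
move=> c1 c2; apply: (@initial_continuous_at _ _ _ (@sum_proj K X xi eta)).
exact: (pair_continuous_at c1 c2).
Qed.

Lemma whitney_fst_continuous : continuous (fun e : total_space
  (whitney_sum xi eta) => in_total (projT2 e).1 : total_space xi).
Proof.
move=> e; have c0 : {for e, continuous (fst \o (@sum_proj K X xi eta :
    total_space (whitney_sum xi eta) -> _))}.
  by apply: continuous_comp; [exact: initial_continuous|exact: cvg_fst].
exact: c0.
Qed.

Lemma whitney_snd_continuous : continuous (fun e : total_space
  (whitney_sum xi eta) => in_total (projT2 e).2 : total_space eta).
Proof.
move=> e; have c0 : {for e, continuous (snd \o (@sum_proj K X xi eta :
    total_space (whitney_sum xi eta) -> _))}.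
  by apply: continuous_comp; [exact: initial_continuous|exact: cvg_snd].
exact: c0.
Qed.

Lemma within_preimage_continuous (zeta : vfamily K X) (Y : topologicalType)
    (U : set X) (f : total_space zeta -> Y) :
  continuous (@bundle_proj K X zeta) -> open U ->
  (forall e : total_space zeta, U (projT1 e) -> {for e, continuous f}) ->
  {within @bundle_proj K X zeta @^-1` U, continuous f}.
Proof.
move=> cp oU cf; rewrite continuous_open_subspace; last by apply: open_comp.
by move=> e /set_mem Ue; exact: cf.
Qed.

End ProductAndSum.

(** * Trivializations and the construction of sections *)

Section Charts.
Local Open Scope classical_set_scope.
Local Open Scope ring_scope.
Context (K : numFieldType) (X : topologicalType) (xi : vfamily K X).

(** A local trivialization with the total space of the product family unfolded to X * K^n, so that
    continuity can be checked at single points. Outside [cdom] the linear maps are unconstrained. *)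
Record chart := Chart {
  cdom : set X ;
  crank : nat ;
  coords : forall x, {linear fiber xi x -> 'rV[K]_crank} ;
  frame : forall x, {linear 'rV[K]_crank -> fiber xi x} ;
  cdom_open : open cdom ;
  coordsK : forall x, cdom x -> cancel (coords x) (frame x) ;
  frameK : forall x, cdom x -> cancel (frame x) (coords x) ;
  coords_continuous : forall e : total_space xi, cdom (projT1 e) ->
    {for e, continuous (fun e' : total_space xi =>
                          coords (projT1 e') (projT2 e'))} ;
  frame_continuous : forall z : X * 'rV[K]_crank, cdom z.1 ->
    {for z, continuous (fun z' : X * 'rV[K]_crank =>
                          in_total (frame z'.1 z'.2))}
}.

Lemma coords_section (c : chart) (s : forall x, fiber xi x) (x : X) :
  cdom c x -> {for x, continuous (fun y => in_total (s y))} ->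
  {for x, continuous (fun y => coords c y (s y))}.
Proof.
move=> cx cs; exact: (continuous_comp cs (coords_continuous (_ : cdom c _))).
Qed.

Lemma frame_section (Y : topologicalType) (c : chart) (p : Y -> X)
    (w : Y -> 'rV[K]_(crank c)) (y : Y) :
  cdom c (p y) -> {for y, continuous p} -> {for y, continuous w} ->
  {for y, continuous (fun z => in_total (frame c (p z) (w z)))}.
Proof.
move=> cx cp cw.
have := continuous_comp (pair_continuous_at cp cw).
by move=> /(_ _ (fun z' => in_total (frame c z'.1 z'.2))); apply;
  exact: frame_continuous.
Qed.

Lemma crank_eq (c : chart) (x : X) : cdom c x -> crank c = \dim {: fiber xi x}.
Proof.
move=> cx; pose f := linfun (coords c x).
have f0 : lker f == 0%VS.
  apply/lker0P => u v; rewrite !lfunE /= => /(congr1 (frame c x)).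
  by rewrite !coordsK.
have f1 : limg f = fullv.
  apply/vspaceP => w; rewrite memvf; apply/memv_imgP.
  by exists (frame c x w); rewrite ?memvf // lfunE /= frameK.
have := limg_ker_dim f fullv; rewrite (eqP f0) capv0 dimv0 add0n f1 => <-.
by rewrite dimvf dim_matrix mul1r.
Qed.

End Charts.

Section ChartOfTrivialization.
Local Open Scope classical_set_scope.
Local Open Scope ring_scope.
Context (K : numFieldType) (X : topologicalType).

Lemma chart_of_trivial (xi : vfamily K X) (U : set X) :
  continuous (@bundle_proj K X xi) -> open U -> trivial_over U xi ->
  exists c : chart xi, cdom c = U.
Proof.
move=> cpi oU [n [h [k [hk ch ck]]]].
have oUxi : open (@bundle_proj K X xi @^-1` U) by apply: open_comp.
have oUn : open (@bundle_proj K X (product_family K X n) @^-1` U).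
  by apply: open_comp => // e _; exact: product_bundle_proj_continuous.
have := ch; rewrite continuous_open_subspace // => {}ch.
have := ck; rewrite continuous_open_subspace // => {}ck.
unshelve eexists (@Chart K X xi U n h k oU _ _ _ _) => //.
- by move=> x /hk[].
- by move=> x /hk[].
- move=> e Ue; have che := ch e (mem_set Ue).
  have c2 : {for e, continuous ((fun e' : total_space (product_family K X n) =>
      projT2 e' : 'rV[K]_n) \o total_map h)}.
    by apply: continuous_comp; [exact: che|exact: product_snd_continuous].
  exact: c2.
- move=> z Uz; pose i (z' : X * 'rV[K]_n) : total_space (product_family K X n) :=
    @in_total K X (product_family K X n) z'.1 z'.2.
  have ci : {for z, continuous i}.
    by apply: product_continuous_at; [exact: cvg_fst|exact: cvg_snd].
  exact: (continuous_comp ci (ck (i z) (mem_set Uz))).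
Qed.

End ChartOfTrivialization.

(** * Construction of one more independent section *)

Section NextSection.
Local Open Scope classical_set_scope.
Local Open Scope ring_scope.

(* Bundles are handled over an abstract [K], because the norm topology of [R[i]]
   is only found when [R[i]] is seen as a [numFieldType]. *)
Record real_plane (R : realType) (K : numFieldType) := RealPlane {
  re_part : K -> R ;
  im_part : K -> R ;
  of_parts : R -> R -> K ;
  re_partD : {morph re_part : z w / z + w} ;
  im_partD : {morph im_part : z w / z + w} ;
  re_of_parts : forall a b, re_part (of_parts a b) = a ;
  im_of_parts : forall a b, im_part (of_parts a b) = b ;
  of_partsK : forall z, of_parts (re_part z) (im_part z) = z ;
  of_parts10 : of_parts 1 0 = 1 ;
  re_part_continuous : continuous re_part ;
  im_part_continuous : continuous im_part ;
  of_parts_continuous : continuous (fun z : R * R => of_parts z.1 z.2)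
}.

Context (R : realType) (K : numFieldType) (P : real_plane R K).
Context (X : topologicalType) (xi : vfamily K X).
Implicit Types (c : chart xi) (x : X).

Lemma re_part0 : re_part P 0 = 0.
Proof. by apply: (@addrI _ (re_part P 0)); rewrite -re_partD !addr0. Qed.

Lemma im_part0 : im_part P 0 = 0.
Proof. by apply: (@addrI _ (im_part P 0)); rewrite -im_partD !addr0. Qed.

Lemma of_parts0 : of_parts P 0 0 = 0.
Proof. by rewrite -[RHS](of_partsK P) re_part0 im_part0. Qed.

Definition part (b : bool) : K -> R := if b then im_part P else re_part P.

Lemma part_neq0 (z : K) : z != 0 -> exists b, part b z != 0.
Proof.
move=> z0; apply/existsP; rewrite -[X in is_true X]negbK negb_exists.
apply: contraNN z0 => /forallP h.
have := h true; have := h false; rewrite !negbK /= => /eqP r0 /eqP i0.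
by rewrite -[z](of_partsK P) r0 i0 of_parts0.
Qed.

Definition adapted (j : nat) (s : nat -> forall x, fiber xi x) c :=
  forall (l : nat) x, (l < j)%N -> cdom c x ->
    forall p, coords c x (s l x) 0 p = ((p : nat) == l)%:R.

(** In an adapted chart, and over its domain, this says that [v] lies outside the span of the first
    [j] sections. *)
Definition escapes (j : nat) c x (v : fiber xi x) :=
  exists2 p : 'I_(crank c), (j <= p)%N & coords c x v 0 p != 0.

(** Lying outside the span of the sections does not depend on the chart: if all tail coordinates in
    [c'] vanished, [v] would be a combination of the first [j] sections, and its tail in [c] would
    vanish as well. *)
Lemma escapes_chart (j : nat) (s : nat -> forall x, fiber xi x) c c' x
    (v : fiber xi x) :
  adapted j s c -> adapted j s c' -> cdom c x -> cdom c' x ->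
  escapes j c v -> escapes j c' v.
Proof.
move=> sc sc' cx cx' [q jq vq]; apply: contrapT => nesc.
have tail0 (p : 'I_(crank c')) : (j <= p)%N -> coords c' x v 0 p = 0.
  by move=> jp; apply/eqP/negbNE/negP => vp; apply: nesc; exists p.
have vE : v = \sum_(p < crank c' | (p < j)%N) coords c' x v 0 p *: s p x.
  apply: (can_inj (coordsK cx')); rewrite linear_sum.
  apply/rowP => r; rewrite summxE.
  have [rj|jr] := ltnP r j; last first.
    rewrite tail0 // big1 // => p pj; rewrite linearZ !mxE sc' //.
    by rewrite gtn_eqF ?mulr0 // (leq_trans pj).
  rewrite (bigD1 r) //= linearZ !mxE sc' // eqxx mulr1.
  rewrite big1 ?addr0 // => p /andP[pj pr]; rewrite linearZ !mxE sc' //.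
  by rewrite eq_sym (negPf pr : (p == r :> nat) = false) mulr0.
move: vq; rewrite vE linear_sum summxE big1 ?eqxx // => p pj.
by rewrite linearZ !mxE sc // gtn_eqF ?mulr0 // (leq_trans pj).
Qed.

Lemma coords_section_entry c (t : forall x, fiber xi x) x p : cdom c x ->
  {for x, continuous (fun y => in_total (t y))} ->
  {for x, continuous (fun y => coords c y (t y) 0 p)}.
Proof.
by move=> cx ct; apply: (matrix_continuousP _ _).2; exact: coords_section.
Qed.

Lemma open_escapes (I : Type) (c : I -> chart xi) (j : nat)
    (t : forall x, fiber xi x) :
  continuous (fun x => in_total (t x)) ->
  open [set x | exists2 i, cdom (c i) x & escapes j (c i) (t x)].
Proof.
move=> ct; rewrite openE => x [i ix [p jp vp]].
have cp : {for x, continuous (fun y => coords (c i) y (t y) 0 p)}.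
  by apply: coords_section_entry => //; exact: ct.
have : \forall y \near x, coords (c i) y (t y) 0 p != 0.
  exact: (cvgr_neq0 _ cp).
apply: filterS2 (near_open (cdom_open _) ix) => y iy yp.
by exists i => //; exists p.
Qed.

(* The boolean selects the real or the imaginary part of the coordinate. *)
Definition tail_index c (j : nat) : finType :=
  ({p : 'I_(crank c) | (j <= p)%N} * bool)%type.

Lemma card_tail_index c j : #|{: tail_index c j}| = (2 * (crank c - j))%N.
Proof.
rewrite card_prod card_bool card_sig mulnC; congr (_ * _)%N.
rewrite -sum1_card (eq_bigl (fun p : 'I_(crank c) => (j <= p)%N)) //.
rewrite -(big_mkord (fun p => (j <= p)%N) (fun=> 1%N)).
rewrite (big_cat_nat (n := minn j (crank c))) ?geq_minr //=.
rewrite big_nat_cond big1 ?add0n; last first.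
  by move=> p /andP[/andP[_]]; rewrite leq_min => /andP[pj _]; rewrite leqNgt pj.
rewrite big_nat_cond (eq_bigl (fun p => (minn j (crank c) <= p < crank c)%N)).
  rewrite -big_nat sum_nat_const_nat muln1.
  have [jc|cj] := leqP j (crank c); first by [].
  by rewrite subnn; lia.
move=> p; apply/andb_idr => /andP[h1 h2]; move: h1; rewrite geq_min.
by case/orP => // h; have := leq_ltn_trans h h2; rewrite ltnn.
Qed.

(** The correction is made on the real and imaginary parts of the tail coordinates of [t] in the
    chart [c i]. It vanishes on [A] and near every point outside the chart, hence extends by zero to
    a section over X. *)
Lemma extend_section_over (I : finType) (c : I -> chart xi) (j d : nat)
    (s : nat -> forall x, fiber xi x) (i : I) (A : set X) (chi : X -> R) (a : R)
    (t : forall x, fiber xi x) :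
  normal_space X -> covering_dim_le X d -> (d < 2 * (crank (c i) - j))%N ->
  (forall i, adapted j s (c i)) ->
  continuous chi -> (forall x, 0 <= chi x) -> 0 < a ->
  (forall x, ~ cdom (c i) x -> \forall y \near x, chi y = 0) ->
  closed A -> continuous (fun x => in_total (t x)) ->
  A `<=` [set x | exists2 i, cdom (c i) x & escapes j (c i) (t x)] ->
  exists2 t' : forall x, fiber xi x, continuous (fun x => in_total (t' x)) &
    A `|` [set x | a <= chi x] `<=`
      [set x | exists2 i, cdom (c i) x & escapes j (c i) (t' x)].
Proof.
move=> nX dX; rewrite -card_tail_index => dL ad cchi chi0 a0 chiU cA ct At.
pose g (l : tail_index (c i) j) x := part l.2 (coords (c i) x (t x) 0 (val l.1)).
have cpart b : continuous (part b).
  by case: b; [exact: im_part_continuous|exact: re_part_continuous].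
have cg l x : cdom (c i) x -> {for x, continuous (g l)}.
  move=> ix; apply: (@continuous_comp _ _ _
    (fun y => coords (c i) y (t y) 0 (val l.1)) (part l.2)); last exact: cpart.
  by apply: coords_section_entry => //; exact: ct.
have [|r [cr rU rA rB]] := nonvanishing_correction nX dX dL cchi chi0 a0 chiU cA
    (open_escapes c j ct) At cg.
- move=> x ix [i' ix' /(escapes_chart (ad i') (ad i) ix' ix)[p jp]].
  by case/part_neq0 => b pb; exists (Sub p jp, b).
(* Coordinates of index below [j] receive no correction. *)
pose w x : 'rV[K]_(crank (c i)) := \row_p
  if insub p is Some q then of_parts P (r (q, false) x) (r (q, true) x) else 0.
have w0 x : (forall l, r l x = 0) -> w x = 0.
  move=> r0; apply/rowP => p; rewrite !mxE; case: insubP => // q _ _.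
  by rewrite !r0 of_parts0.
have cw : continuous w.
  move=> x; apply/matrix_continuousP => a1 p; rewrite /w.
  apply: (@eq_continuous_at _ _ (fun y =>
    if insub p is Some q then of_parts P (r (q, false) y) (r (q, true) y) else 0)).
    by move=> y; rewrite mxE.
  case: insubP => [q _ _|_]; last exact: cst_continuous.
  apply: (@continuous_comp _ _ _ (fun y => (r (q, false) y, r (q, true) y))
    (fun z : R * R => of_parts P z.1 z.2)); last exact: of_parts_continuous.
  by apply: pair_continuous_at; exact: cr.
exists (fun x => t x + frame (c i) x (w x)).
  (* Inside the chart, continuity of the sum is read off in coordinates; near a point outside it,
     the section is unchanged. *)
  move=> x; have [ix|nix] := pselect (cdom (c i) x); last first.
    apply: eq_near_continuous (ct x); apply: filterS (rU x nix) => y /w0 ->.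
    by rewrite linear0 addr0.
  apply: (@eq_near_continuous _ _ (fun y =>
      in_total (frame (c i) y (coords (c i) y (t y) + w y)))).
    apply: filterS (near_open (cdom_open _) ix) => y iy.
    by rewrite linearD coordsK.
  apply: (@frame_section _ _ _ X (c i) id) => //.
  apply/matrix_continuousP => a1 p; rewrite ord1.
  apply: (@eq_continuous_at _ _ ((fun y => coords (c i) y (t y) 0 p) \+
    (fun y => w y 0 p))); first by move=> y; rewrite mxE.
  apply: continuousD; last exact: ((matrix_continuousP _ _).2 (cw x)).
  by apply: coords_section_entry => //; exact: ct.
move=> x [Ax|ax] /=.
  have [i' ix' esc] := At x Ax; exists i' => //.
  by rewrite w0 ?linear0 ?addr0 // => l; exact: rA.
have ix : cdom (c i) x.
  apply: contrapT => /chiU/nbhs_singleton chix; move: ax => /=.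
  by rewrite chix leNgt a0.
exists i => //; have [[[p jp] b] gr] := rB x ix ax; exists p => //.
rewrite linearD frameK // mxE [w x 0 p]mxE insubT.
apply: contraNN gr; rewrite /g /= => /eqP h0.
have := congr1 (part b) h0.
case: b; rewrite /= ?re_partD ?im_partD ?re_of_parts ?im_of_parts.
  by rewrite im_part0 => ->.
by rewrite re_part0 => ->.
Qed.

(** The charts are treated one after another, starting from [t]. Each step keeps the escape already
    achieved on the closed sets chi i >= a and achieves it on one more; together these sets cover
    X. *)
Lemma next_section (I : finType) (c : I -> chart xi) (j d : nat)
    (s : nat -> forall x, fiber xi x) (t : forall x, fiber xi x) :
  normal_space X -> covering_dim_le X d -> \bigcup_i cdom (c i) = setT ->
  (forall i x, cdom (c i) x -> (d < 2 * (crank (c i) - j))%N) ->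
  (forall i, adapted j s (c i)) -> continuous (fun x => in_total (t x)) ->
  exists2 t' : forall x, fiber xi x, continuous (fun x => in_total (t' x)) &
    forall x, exists2 i, cdom (c i) x & escapes j (c i) (t' x).
Proof.
move=> nX dX cov rk ad ct.
have covU : open_covering (fun i => cdom (c i)).
  by split=> // i; exact: cdom_open.
have [chi [cchi chi0 chi1 chiU]] := partition_of_unity R nX covU.
(* If every [chi i x] were below [a], their sum would be at most #|I| / (#|I| + 1) < 1. *)
pose a : R := (#|I|.+1%:R)^-1.
have a0 : 0 < a by rewrite invr_gt0 ltr0n.
have [t' ct' esc] : exists2 t' : forall x, fiber xi x,
    continuous (fun x => in_total (t' x)) &
    \bigcup_(i in [set` enum I]) [set x | a <= chi i x] `<=`
    [set x | exists2 i, cdom (c i) x & escapes j (c i) (t' x)].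
  elim: (enum I) => [|i r [t' ct' esc]].
    by exists t => //; rewrite bigcup_seq big_nil.
  (* The rank bound is available only at a point of the chart; if [chi i] nowhere reaches [a], there
     is nothing to correct. *)
  have [[x ax]|nax] := pselect (exists x, a <= chi i x); last first.
    exists t' => // x [k /=]; rewrite inE => /orP[/eqP ->|kr] ak.
      by case: nax; exists x.
    by apply: esc; exists k.
  have ix : cdom (c i) x.
    apply: contrapT => /chiU/nbhs_singleton chix; move: ax => /=.
    by rewrite chix leNgt a0.
  have [|t'' ct'' esc'] := extend_section_over nX dX (rk i x ix) ad (cchi i)
    (chi0 i) a0 (chiU i) _ ct' esc.
    rewrite bigcup_seq; apply: big_ind => [|B B'|k _]; first exact: closed0.
      exact: closedU.
    apply: (@preimage_closed _ _ (chi k) [set z | a <= z]) => [y _|].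
      exact: cchi.
    exact: closed_ge.
  exists t'' => // y [k /=]; rewrite inE => /orP[/eqP ->|kr] ak; apply: esc'.
    by right.
  by left; exists k.
exists t' => // x; apply: esc.
apply: contrapT => h; have := chi1 x; apply/eqP; rewrite lt_eqF //.
apply: (@le_lt_trans _ _ (\sum_(i : I) a)).
  apply: ler_sum => i _; rewrite leNgt; apply/negP => ai; apply: h; exists i => /=.
    by rewrite mem_enum.
  exact: ltW.
by rewrite sumr_const -[ltLHS]mulr_natl ltr_pdivrMr ?ltr0n // mul1r ltr_nat.
Qed.

End NextSection.

(** * Shears turning a vector into a basis vector *)

Section Shear.
Local Open Scope ring_scope.
Context (K : fieldType) (n : nat) (p q : 'I_n).
Implicit Types g : 'rV[K]_n.

(* When [g 0 p != 0], right multiplication by [shear g] exchanges the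
   coordinates [p] and [q], then maps the image of [g] to the basis vector [q]
   while fixing the other basis vectors. *)
Definition shear_row g : 'rV[K]_n := g *m tperm_mx p q - delta_mx 0 q.

Definition shear g : 'M[K]_n :=
  tperm_mx p q *m (1%:M - delta_mx q 0 *m ((g 0 p)^-1 *: shear_row g)).

Definition unshear g : 'M[K]_n :=
  (1%:M + delta_mx q 0 *m shear_row g) *m tperm_mx p q.

Lemma tperm_mxK : tperm_mx p q *m tperm_mx p q = 1%:M :> 'M[K]_n.
Proof. by rewrite -perm_mxM tperm2 perm_mx1. Qed.

Lemma mul_row_delta (v : 'rV[K]_n) (k : 'I_n) :
  v *m delta_mx k 0 = (v 0 k)%:M :> 'M[K]_1.
Proof.
apply/rowP => i; rewrite !mxE (bigD1 k) //= big1 => [|r /negPf rk].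
  by rewrite !mxE !ord1 !eqxx mulr1 addr0.
by rewrite !mxE rk mulr0.
Qed.

Lemma mul_row_tperm (v : 'rV[K]_n) k : (v *m tperm_mx p q) 0 k = v 0 (tperm p q k).
Proof. by rewrite -xcolE mxE. Qed.

Lemma shear_row_q g : shear_row g 0 q = g 0 p - 1.
Proof. by rewrite mxE mul_row_tperm tpermR !mxE !eqxx. Qed.

Lemma mul_row_shear g v :
  v *m shear g = v *m tperm_mx p q - (v 0 p / g 0 p) *: shear_row g.
Proof.
rewrite mulmxA mulmxBr mulmx1 mulmxA mul_row_delta mul_row_tperm tpermR.
by rewrite mul_scalar_mx scalerA.
Qed.

(** Inversion of a rank-one perturbation of the identity (Sherman-Morrison): for the column [u] and
    the row [w], 1 + w u is the scalar [g 0 p]. *)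
Lemma shearK g : g 0 p != 0 -> shear g *m unshear g = 1%:M.
Proof.
move=> gp; rewrite /shear /unshear; set u := delta_mx q 0.
set w := shear_row g.
have wu : w *m u = (g 0 p - 1)%:M by rewrite mul_row_delta shear_row_q.
have uw : (u *m ((g 0 p)^-1 *: w)) *m (1%:M + u *m w) = u *m w.
  rewrite -scalemxAr -scalemxAl mulmxDr mulmx1 mulmxA -(mulmxA u w u) wu.
  rewrite mul_mx_scalar -scalemxAl -[X in _ *: (X + _)]scale1r -scalerDl.
  by rewrite addrC subrK scalerA mulVf // scale1r.
rewrite mulmxA -(mulmxA (tperm_mx p q)) mulmxBl mul1mx uw addrK mulmx1.
exact: tperm_mxK.
Qed.

Lemma unshearK g : g 0 p != 0 -> unshear g *m shear g = 1%:M.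
Proof. by move=> /shearK/mulmx1C. Qed.

Lemma shear_fix g (l : 'I_n) : l != p -> l != q ->
  delta_mx 0 l *m shear g = delta_mx 0 l :> 'rV[K]_n.
Proof.
move=> lp lq; rewrite mul_row_shear mxE eqxx eq_sym (negPf lp) mul0r scale0r.
rewrite subr0; apply/rowP => k; rewrite mul_row_tperm !mxE.
by rewrite -(inj_eq (@perm_inj _ (tperm p q))) tpermK tpermD // eq_sym.
Qed.

Lemma shear_image g : g 0 p != 0 -> g *m shear g = delta_mx 0 q.
Proof.
by move=> gp; rewrite mul_row_shear divff // scale1r opprB addrCA subrr addr0.
Qed.

End Shear.

(** * Trivializations adapted to the sections *)

Section Refinement.
Local Open Scope classical_set_scope.
Local Open Scope ring_scope.

Section ShearContinuity.
Context (K : numFieldType) (X : topologicalType) (n : nat) (p q : 'I_n).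
Context (g : X -> 'rV[K]_n) (x : X) (cg : {for x, continuous g}).

Let shear_row_continuous : {for x, continuous (fun y => shear_row p q (g y))}.
Proof.
apply: submx_continuous; last exact: cst_continuous.
by apply: mulmx_continuous; [exact: cg|exact: cst_continuous].
Qed.

Lemma shear_continuous : g x 0 p != 0 ->
  {for x, continuous (fun y => shear p q (g y))}.
Proof.
move=> gp; apply: mulmx_continuous; first exact: cst_continuous.
apply: submx_continuous; first exact: cst_continuous.
apply: mulmx_continuous; first exact: cst_continuous.
apply: scalemx_continuous; last exact: shear_row_continuous.
by apply: continuousV => //; exact: ((matrix_continuousP _ _).2 cg).
Qed.

Lemma unshear_continuous : {for x, continuous (fun y => unshear p q (g y))}.
Proof.
apply: mulmx_continuous; last exact: cst_continuous.
apply: addmx_continuous; first exact: cst_continuous.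
by apply: mulmx_continuous; [exact: cst_continuous|exact: shear_row_continuous].
Qed.

End ShearContinuity.

Context (K : numFieldType) (X : topologicalType) (xi : vfamily K X).
Context (cpi : continuous (@bundle_proj K X xi)).

Definition add_section (j : nat) (t : forall x, fiber xi x)
    (s : nat -> forall x, fiber xi x) : nat -> forall x, fiber xi x :=
  fun l => if l == j then t else s l.

(** The chart is restricted to the open set where coordinate [p] of [t] is nonzero, then followed by
    the shear that turns [t] into basis vector [j]. A basis vector of index below [j] differs from
    both exchanged ones, so it stays fixed. *)
Lemma refine_chart (c : chart xi) (j : nat) (p : 'I_(crank c))
    (s : nat -> forall x, fiber xi x) (t : forall x, fiber xi x) :
  (j <= p)%N -> continuous (fun x => in_total (t x)) -> adapted j s c ->
  exists2 c' : chart xi,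
    cdom c' = [set x | cdom c x /\ coords c x (t x) 0 p != 0] &
    adapted j.+1 (add_section j t s) c'.
Proof.
move=> jp ct ad; pose q := Ordinal (leq_ltn_trans jp (ltn_ord p)).
pose g x := coords c x (t x).
pose U := [set x | cdom c x /\ g x 0 p != 0].
have cg x : U x -> {for x, continuous g}.
  by case=> cx _; apply: coords_section => //; exact: ct.
pose h x : {linear fiber xi x -> 'rV[K]_(crank c)} :=
  mulmxr (shear p q (g x)) \o coords c x.
pose k x : {linear 'rV[K]_(crank c) -> fiber xi x} :=
  frame c x \o mulmxr (unshear p q (g x)).
have oU : open U.
  rewrite openE => x [cx gx].
  have cp : {for x, continuous (fun y => g y 0 p)}.
    by apply: coords_section_entry => //; exact: ct.
  apply: filterS2 (near_open (cdom_open _) cx) (cvgr_neq0 _ cp gx) => y cy gy.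
  by split.
have hk x : U x -> cancel (h x) (k x).
  by move=> [cx gx] v; rewrite /= -mulmxA shearK // mulmx1; exact: coordsK.
have kh x : U x -> cancel (k x) (h x).
  by move=> [cx gx] v; rewrite /= frameK // -mulmxA unshearK // mulmx1.
have ch (e : total_space xi) : U (projT1 e) ->
    {for e, continuous (fun e' : total_space xi => h (projT1 e') (projT2 e'))}.
  move=> Ue; have [ce _] := Ue.
  apply: (@mulmx_continuous _ _ _ _ _
    (fun e' : total_space xi => coords c (projT1 e') (projT2 e'))
    (fun e' : total_space xi => shear p q (g (projT1 e')))).
    exact: coords_continuous.
  apply: (@continuous_comp _ _ _ (@bundle_proj K X xi)
    (fun y => shear p q (g y))); first exact: cpi.
  by apply: shear_continuous; [exact: cg|case: Ue].
have ck (z : X * 'rV[K]_(crank c)) : U z.1 ->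
    {for z, continuous (fun z' : X * 'rV[K]_(crank c) =>
                          in_total (k z'.1 z'.2))}.
  move=> Uz; have [cz _] := Uz.
  have cw : {for z, continuous (fun z' : X * 'rV[K]_(crank c) =>
      z'.2 *m unshear p q (g z'.1))}.
    apply: mulmx_continuous; first exact: cvg_snd.
    apply: (@continuous_comp _ _ _ fst (fun y => unshear p q (g y))).
      exact: cvg_fst.
    by apply: unshear_continuous; exact: cg.
  have cz1 : {for z, continuous (fun z' : X * 'rV[K]_(crank c) => z'.1)}.
    exact: cvg_fst.
  exact: (frame_section cz cz1 cw).
exists (Chart oU hk kh ch ck) => //.
move=> l x lj [cx gx] a; rewrite /add_section /=.
  have [->|nlj] := eqVneq l j; first by rewrite shear_image // mxE eqxx.
  have {nlj}lj : (l < j)%N by rewrite ltn_neqAle nlj.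
  pose l' := Ordinal (ltn_trans lj (ltn_ord q)).
  have -> : coords c x (s l x) = delta_mx 0 l'.
    by apply/rowP => b; rewrite mxE eqxx ad.
  have lp : l' != p by rewrite -val_eqE /= ltn_eqF // (leq_trans lj).
  have lq : l' != q by rewrite -val_eqE /= ltn_eqF.
  by rewrite shear_fix // mxE eqxx.
Qed.

(** Induction on [j]: [next_section] supplies the new section, and each chart is cut into the pieces
    on which a given tail coordinate of that section is nonzero. The pieces cover X because the
    section escapes everywhere. *)
Lemma adapted_cover (R : realType) (P : real_plane R K) (d b : nat)
    (I0 : finType) (c0 : I0 -> chart xi) :
  normal_space X -> covering_dim_le X d -> \bigcup_i cdom (c0 i) = setT ->
  (forall x, (b <= \dim {: fiber xi x})%N) ->
  continuous (fun x => in_total (0 : fiber xi x)) ->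
  forall j, (forall l, (l < j)%N -> (d < 2 * (b - l))%N) ->
  exists (I : finType) (c : I -> chart xi) (s : nat -> forall x, fiber xi x),
    [/\ \bigcup_i cdom (c i) = setT,
        forall l, (l < j)%N -> continuous (fun x => in_total (s l x)) &
        forall i, adapted j s (c i)].
Proof.
move=> nX dX cov0 rk c00; elim=> [_|j IHj dj].
  by exists I0, c0, (fun l x => 0); split.
have [l lj|I [c [s [cov cs ad]]]] := IHj; first by apply: dj; exact: ltnW.
have [|t ct esc] := next_section P nX dX cov _ ad c00.
  move=> i x ix; apply: leq_trans (dj j (ltnSn j)) _.
  by rewrite leq_mul2l /= leq_sub2r // (crank_eq ix).
have ref (ip : {i : I & {p : 'I_(crank (c i)) | (j <= p)%N}}) :
    exists c' : chart xi,
    cdom c' = [set x | cdom (c (tag ip)) x /\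
      coords (c (tag ip)) x (t x) 0 (val (tagged ip)) != 0] /\
    adapted j.+1 (add_section j t s) c'.
  have [c' dc' ac'] := refine_chart (valP (tagged ip)) ct (ad (tag ip)).
  by exists c'.
have [c' c'P] := choice ref.
exists {i : I & {p : 'I_(crank (c i)) | (j <= p)%N}}, c', (add_section j t s).
split.
- rewrite -subTset => x _; have [i ix [p jp px]] := esc x.
  exists (Tagged (fun i => {p : 'I_(crank (c i)) | (j <= p)%N}) (Sub p jp)) => //.
  by rewrite (c'P _).1.
- move=> l lj; rewrite /add_section.
  have [_|nlj] := eqVneq l j; first exact: ct.
  by apply: cs; rewrite ltn_neqAle nlj.
- by move=> ip; exact: (c'P ip).2.
Qed.

End Refinement.

(** * Splitting off the sections *)

Section TailMatrix.
Local Open Scope ring_scope.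
Context (K : fieldType) (n k : nat).

(** Right multiplication drops the first [k] coordinates; right multiplication by the transpose puts
    zeros back in front. *)
Definition tail_mx : 'M[K]_(n, n - k) :=
  \matrix_(a, b) ((a : nat) == (b + k)%N)%:R.

Let shift_lt (b : 'I_(n - k)) : (b + k < n)%N.
Proof. by rewrite addnC -ltn_subRL. Qed.

Let shift (b : 'I_(n - k)) : 'I_n := Ordinal (shift_lt b).

Lemma mul_tail_mx (v : 'rV[K]_n) b : (v *m tail_mx) 0 b = v 0 (shift b).
Proof.
rewrite mxE (bigD1 (shift b)) //= mxE eqxx mulr1 big1 ?addr0 // => a ab.
by rewrite mxE (negPf (ab : (a : nat) != _)) mulr0.
Qed.

Lemma tail_mxK : tail_mx^T *m tail_mx = 1%:M.
Proof.
apply/matrixP => b b'; rewrite mxE (bigD1 (shift b)) //= !mxE eqxx mul1r.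
rewrite eqn_add2r big1 ?addr0 // => a ab.
by rewrite !mxE (negPf (ab : (a : nat) != _)) mul0r.
Qed.

Lemma mul_tail_trmx (v : 'rV[K]_n) (a : 'I_n) :
  (v *m tail_mx *m tail_mx^T) 0 a = if (k <= a)%N then v 0 a else 0.
Proof.
rewrite mxE; case: leqP => ka; last first.
  rewrite big1 // => b _; rewrite !mxE ltn_eqF ?mulr0 //.
  by rewrite (leq_trans ka) // leq_addl.
have ank : (a - k < n - k)%N by rewrite ltn_sub2r // (leq_ltn_trans ka).
rewrite (bigD1 (Ordinal ank)) //= mul_tail_mx big1 ?addr0 => [|b ba].
  rewrite !mxE /= subnK // eqxx mulr1; congr (v _ _).
  by apply: val_inj; rewrite /= subnK.
rewrite !mxE; case: eqP => [ab|_]; last by rewrite mulr0.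
by case/eqP: ba; apply: val_inj; rewrite /= ab addnK.
Qed.

Lemma row_mul_tail (v : 'rV[K]_n) :
  (forall a : 'I_n, (k <= a)%N -> v 0 a = 0) -> v *m tail_mx = 0.
Proof.
by move=> v0; apply/rowP => b; rewrite mul_tail_mx mxE v0 //= leq_addl.
Qed.

End TailMatrix.

(** * The splitting defined by the sections *)

Section Splitting.
Local Open Scope classical_set_scope.
Local Open Scope ring_scope.

Definition linear_of (K : pzRingType) (U V : lmodType K) (f : U -> V)
    (lf : linear f) : {linear U -> V} :=
  HB.pack f (GRing.isLinear.Build K U V *:%R f lf).

Context (K : numFieldType) (X : topologicalType) (xi : vbundle K X).
Context (I : finType) (c : I -> chart xi) (k : nat).
Context (s : nat -> forall x, fiber xi x).
Context (cov : \bigcup_i cdom (c i) = setT).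
Context (cs : forall l, (l < k)%N -> continuous (fun x => in_total (s l x))).
Context (ad : forall i, adapted k s (c i)).
Context (kc : forall i x, cdom (c i) x -> (k <= crank (c i))%N).

(** In each chart the first [k] coordinates send [s l] to basis vector [l]. This condition is
    affine, so it survives averaging by a partition of unity. *)
Lemma splitting_projection (R : realType) (P : real_plane R K) :
  normal_space X ->
  exists pi : forall x, {linear fiber xi x -> 'rV[K]_k},
    (forall x (l : 'I_k), pi x (s l x) = delta_mx 0 l) /\
    continuous (fun e : total_space xi => pi (projT1 e) (projT2 e)).
Proof.
move=> nX.
have covU : open_covering (fun i => cdom (c i)).
  by split=> // i; exact: cdom_open.
have [chi [cchi chi0 chi1 chiU]] := partition_of_unity R nX covU.
pose r (a : R) : K := of_parts P a 0.
have rD : {morph r : a a' / a + a'}.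
  move=> a a'; rewrite -[RHS](of_partsK P) re_partD im_partD.
  by rewrite !re_of_parts !im_of_parts addr0.
have cr : continuous r.
  move=> a; apply: (@continuous_comp _ _ _ (fun b : R => (b, 0))
    (fun z : R * R => of_parts P z.1 z.2)); last exact: of_parts_continuous.
  by apply: pair_continuous_at; [exact: cvg_id|exact: cst_continuous].
have r0 : r 0 = 0 by exact: of_parts0.
pose f x v := \sum_i r (chi i x) *: (coords (c i) x v *m pid_mx k : 'rV[K]_k).
have lf x : linear (f x).
  move=> a u v; rewrite /f scaler_sumr -big_split; apply: eq_bigr => i _ /=.
  by rewrite linearP mulmxDl -scalemxAl scalerDr !scalerA mulrC.
exists (fun x => linear_of (lf x)); split=> [x l|e].
  rewrite /= /f (eq_bigr (fun i => r (chi i x) *: delta_mx 0 l)) => [|i _].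
    by rewrite -scaler_suml -(big_morph r rD r0) chi1 [r 1]of_parts10 scale1r.
  have [ix|nix] := pselect (cdom (c i) x); last first.
    by rewrite (nbhs_singleton (chiU i x nix)) r0 !scale0r.
  congr (_ *: _); apply/rowP => a; rewrite mxE.
  pose l' := Ordinal (leq_trans (ltn_ord l) (kc ix)).
  rewrite (bigD1 l') //= ad // eqxx mul1r big1 => [|b bl]; last first.
    by rewrite ad // (negPf (bl : (b : nat) != _)) mul0r.
  by rewrite addr0 !mxE /= ltn_ord andbT eq_sym.
apply/matrix_continuousP => a b; rewrite /= /f.
apply: (@eq_continuous_at _ _ (fun e' : total_space xi => \sum_i
    r (chi i (projT1 e')) *
      (coords (c i) (projT1 e') (projT2 e') *m
         (pid_mx k : 'M[K]_(crank (c i), k))) a b)).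
  by move=> y; rewrite summxE; apply: eq_bigr => i _; rewrite [RHS]mxE.
apply: continuous_sumr => i _.
have [ie|nie] := pselect (cdom (c i) (projT1 e)).
  apply: continuousM.
    apply: (@continuous_comp _ _ _ (@bundle_proj K X xi) (r \o chi i)).
      exact: bundle_proj_continuous.
    by apply: continuous_comp; [exact: cchi|exact: cr].
  apply: (matrix_continuousP _ _).2; apply: mulmx_continuous.
    exact: coords_continuous.
  exact: cst_continuous.
apply: (@eq_near_continuous _ _ (fun=> 0)); last exact: cst_continuous.
have : \forall y \near e, chi i (bundle_proj y) = 0.
  exact: (@bundle_proj_continuous K X xi e _ (chiU i _ nie)).
by apply: filterS => y chiy; rewrite [chi i _]chiy r0 mul0r.
Qed.

(** Fibrewise addition is continuous because it becomes vector addition in a chart. This serves both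
    the projection onto the kernel and the inverse of the splitting. *)
Lemma add_sections_continuous (Y : topologicalType) (y : Y)
    (f : Y -> total_space xi) (w : Y -> 'rV[K]_k) :
  {for y, continuous f} -> {for y, continuous w} ->
  {for y, continuous (fun z => in_total
     (projT2 (f z) + \sum_(l < k) w z 0 l *: s l (projT1 (f z))) :
       total_space xi)}.
Proof.
move=> cf cw; have cp : {for y, continuous (fun z => projT1 (f z))}.
  apply: (@continuous_comp _ _ _ f (@bundle_proj K X xi)) => //.
  exact: bundle_proj_continuous.
have [i _ iy] : (\bigcup_i cdom (c i)) (projT1 (f y)) by rewrite cov.
apply: (@eq_near_continuous _ _ (fun z => in_total (frame (c i) (projT1 (f z))
  (coords (c i) (projT1 (f z)) (projT2 (f z)) +
   \sum_(l < k) w z 0 l *: coords (c i) (projT1 (f z)) (s l (projT1 (f z))))))).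
  have : \forall z \near y, cdom (c i) (projT1 (f z)).
    exact: (cp _ (near_open (cdom_open (c i)) iy)).
  apply: filterS => z iz.
  rewrite linearD coordsK // linear_sum; congr (in_total (_ + _)).
  by apply: eq_bigr => l _; rewrite linearZ coordsK.
apply: (@frame_section _ _ _ Y (c i) (fun z => projT1 (f z)) _ y iy cp).
apply: addmx_continuous.
  apply: (@continuous_comp _ _ _ f (fun e : total_space xi =>
    coords (c i) (projT1 e) (projT2 e)) y cf).
  exact: coords_continuous.
apply/matrix_continuousP => a b.
apply: (@eq_continuous_at _ _ (fun z => \sum_(l < k) w z 0 l *
    coords (c i) (projT1 (f z)) (s l (projT1 (f z))) a b)).
  by move=> z; rewrite summxE; apply: eq_bigr => l _; rewrite [RHS]mxE.
apply: continuous_sumr => l _; apply: continuousM.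
  exact: (matrix_continuousP _ _).2.
apply: (@continuous_comp _ _ _ (fun z => projT1 (f z))
  (fun x => coords (c i) x (s l x) a b)) => //.
by rewrite ord1; apply: coords_section_entry => //; exact: cs.
Qed.

Context (pi : forall x, {linear fiber xi x -> 'rV[K]_k}).
Context (pis : forall x (l : 'I_k), pi x (s l x) = delta_mx 0 l).
Context (cpi : continuous (fun e : total_space xi => pi (projT1 e) (projT2 e))).

Let comb x (w : 'rV[K]_k) := \sum_(l < k) w 0 l *: s l x.

Let pi_comb x w : pi x (comb x w) = w.
Proof.
rewrite linear_sum [RHS]row_sum_delta; apply: eq_bigr => l _.
by rewrite linearZ /= pis.
Qed.

Let comb_linear x : linear (comb x).
Proof.
move=> a u v; rewrite /comb scaler_sumr -big_split; apply: eq_bigr => l _ /=.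
by rewrite !mxE scalerDl scalerA.
Qed.

Let combL x : {linear 'rV[K]_k -> fiber xi x} := linear_of (comb_linear x).

Let comb0 x : comb x 0 = 0.
Proof. exact: (linear0 (combL x)). Qed.

Let ker x : {vspace fiber xi x} := lker (linfun (pi x)).

Let mem_ker x v : (v \in ker x) = (pi x v == 0).
Proof. by rewrite memv_ker lfunE. Qed.

(** The projection onto the kernel of [pi] along the span of the sections. *)
Let retract x v := v - comb x (pi x v).

Let retract_linear x : linear (@retract x).
Proof.
move=> a u v; rewrite /retract linearP comb_linear.
by rewrite scalerBr opprD addrACA.
Qed.

Let retractL x : {linear fiber xi x -> fiber xi x} := linear_of (@retract_linear x).

Let retractB x (u v : fiber xi x) : retract (u - v) = retract u - retract v.
Proof. exact: (linearB (retractL x)). Qed.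

Let retractD x (u v : fiber xi x) : retract (u + v) = retract u + retract v.
Proof. exact: (linearD (retractL x)). Qed.

Let retract_ker x (v : fiber xi x) : retract v \in ker x.
Proof. by rewrite mem_ker linearB /= pi_comb subrr. Qed.

Let retract_id x (v : fiber xi x) : v \in ker x -> retract v = v.
Proof.
by rewrite mem_ker /retract => /eqP ->; rewrite comb0 subr0.
Qed.

Let retract_comb x w : retract (comb x w) = 0.
Proof. by rewrite /retract pi_comb subrr. Qed.

Let retract_continuous (Y : topologicalType) (f : Y -> total_space xi) (y : Y) :
  {for y, continuous f} ->
  {for y, continuous (fun z =>
     in_total (retract (projT2 (f z))) : total_space xi)}.
Proof.
move=> cf.
have cw : {for y, continuous (fun z => - pi (projT1 (f z)) (projT2 (f z)))}.
  apply: (@eq_continuous_at _ _ (fun z =>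
    0 - pi (projT1 (f z)) (projT2 (f z)))); first by move=> z; rewrite sub0r.
  apply: submx_continuous; first exact: cst_continuous.
  apply: (@continuous_comp _ _ _ f
    (fun e : total_space xi => pi (projT1 e) (projT2 e)) y cf).
  exact: cpi.
apply: eq_continuous_at (add_sections_continuous cf cw).
move=> z; congr (in_total (_ + _)); rewrite -sumrN.
by apply: eq_bigr => l _; rewrite mxE scaleNr.
Qed.

Let eta := subfamily ker.

Let eta_proj_continuous : continuous (@bundle_proj K X eta).
Proof.
move=> e; have c0 : {for e, continuous (@bundle_proj K X xi \o
    (sub_incl (V := ker) : total_space eta -> total_space xi))}.
  apply: continuous_comp; first exact: sub_incl_continuous.
  exact: bundle_proj_continuous.
exact: c0.
Qed.

(** Over a chart the kernel is a complement of the span of the first [k] basis vectors, so the tail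
    coordinates give an isomorphism; its inverse pads with zeros and retracts to the kernel. *)
Let eta_trivial i : trivial_over (cdom (c i)) eta.
Proof.
set n := crank (c i); pose T := tail_mx K n k.
exists (n - k)%N.
pose h x : {linear subvs_of (ker x) -> 'rV[K]_(n - k)} :=
  mulmxr T \o coords (c i) x \o vsval.
pose g x : {linear 'rV[K]_(n - k) -> subvs_of (ker x)} :=
  vsproj (ker x) \o retractL x \o frame (c i) x \o mulmxr T^T.
exists h, g; split.
- move=> x ix; have combT w : coords (c i) x (comb x w) *m T = 0.
    apply: row_mul_tail => a ka; rewrite linear_sum summxE big1 // => l _.
    by rewrite linearZ mxE ad // gtn_eqF ?mulr0 // (leq_trans _ ka).
  split=> u.
    rewrite /g /h /=; set v := vsval u.
    (* Erasing the first [k] coordinates subtracts a combination of the sections, which [retract]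
       kills. *)
    have -> : coords (c i) x v *m T *m T^T = coords (c i) x (v -
        comb x (\row_l coords (c i) x v 0 (widen_ord (kc ix) l))).
      apply/rowP => a; rewrite mul_tail_trmx linearB linear_sum !mxE summxE.
      case: leqP => [ka|ak].
        rewrite big1 ?subr0 // => l _.
        by rewrite linearZ mxE ad // gtn_eqF ?mulr0 // (leq_trans _ ka).
      rewrite (bigD1 (Ordinal ak)) //= linearZ !mxE ad // eqxx mulr1.
      rewrite big1 => [|l la]; last first.
        rewrite linearZ !mxE ad // eq_sym.
        by rewrite (negPf (la : (l : nat) != _)) mulr0.
      by rewrite addr0 (_ : widen_ord _ _ = a) ?subrr //; exact: val_inj.
    rewrite coordsK // retractB retract_comb subr0.
    by rewrite retract_id ?vsvalK // subvsP.
  rewrite /g /h /= vsprojK ?retract_ker //.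
  by rewrite linearB mulmxBl combT subr0 frameK // -mulmxA tail_mxK mulmx1.
- apply: within_preimage_continuous => //; first exact: cdom_open.
  move=> e ie; apply: product_continuous_at; first exact: eta_proj_continuous.
  apply: mulmx_continuous; last exact: cst_continuous.
  apply: (@continuous_comp _ _ _
    (sub_incl (V := ker) : total_space eta -> total_space xi)
    (fun e' : total_space xi => coords (c i) (projT1 e') (projT2 e'))).
    exact: sub_incl_continuous.
  exact: coords_continuous.
- apply: within_preimage_continuous; [|exact: cdom_open|].
    exact: product_bundle_proj_continuous.
  pose E := total_space (product_family K X (n - k)).
  move=> e ie; have cw : {for e, continuous (fun e' : E =>
      (projT2 e' : 'rV[K]_(n - k)) *m T^T)}.
    apply: mulmx_continuous; last exact: cst_continuous.
    exact: product_snd_continuous.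
  have cp : {for e, continuous (fun e' : E => projT1 e')}.
    exact: product_bundle_proj_continuous.
  apply: subfamily_continuous_at.
  apply: (@eq_continuous_at E _ (fun e' => in_total (retract
      (frame (c i) (projT1 e') ((projT2 e' : 'rV[K]_(n - k)) *m T^T))) :
        total_space xi)).
    by move=> z; rewrite /sub_incl /= vsprojK ?retract_ker.
  exact: (retract_continuous (frame_section ie cp cw)).
Qed.

(** The splitting sends v to (pi v, retract v), with inverse sending (w, u) to u + comb w; the
    complement is the kernel of [pi]. *)
Lemma trivial_summand : has_trivial_summand xi k.
Proof.
have eta_lt x : exists2 U : set X, open_nbhs x U & trivial_over U eta.
  have [i _ ix] : (\bigcup_i cdom (c i)) x by rewrite cov.
  exists (cdom (c i)); last exact: eta_trivial.
  by split=> //; exact: cdom_open.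
exists (VBundle eta_proj_continuous eta_lt).
pose pr x (v : fiber xi x) : 'rV[K]_k * subvs_of (ker x) :=
  (pi x v, vsproj (ker x) (retract v)).
have prL x : linear (@pr x).
  by move=> a u v; rewrite /pr linearP retract_linear linearP.
pose inc x (u : 'rV[K]_k * subvs_of (ker x)) : fiber xi x :=
  vsval u.2 + comb x u.1.
have incL x : linear (@inc x).
  move=> a [u1 u2] [v1 v2].
  rewrite /inc -[vsval _]/(vsval (a *: u2 + v2)) linearP comb_linear.
  by rewrite scalerDr addrACA.
exists (fun x => linear_of (prL x)), (fun x => linear_of (incL x)); split.
- move=> x _; split=> [v|[w u]]; rewrite /= /inc /pr /=.
    by rewrite vsprojK ?retract_ker // subrK.
  have piu : pi x (vsval u) = 0 by apply/eqP; rewrite -mem_ker subvsP.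
  rewrite linearD piu add0r pi_comb; congr (_, _).
  rewrite retractD retract_comb addr0 retract_id ?subvsP //.
  exact: vsvalK.
- apply: within_preimage_continuous; [|exact: openT|].
    exact: bundle_proj_continuous.
  move=> e _; apply: whitney_continuous_at.
    apply: product_continuous_at; first exact: bundle_proj_continuous.
    exact: cpi.
  apply: subfamily_continuous_at.
  apply: (@eq_continuous_at _ _ (fun e' : total_space xi =>
    in_total (retract (projT2 e')) : total_space xi)).
    by move=> z; rewrite /sub_incl /= vsprojK ?retract_ker.
  exact: (@retract_continuous _ (@id (total_space xi)) e (@cvg_id _ _)).
- apply: within_preimage_continuous; [|exact: openT|].
    move=> e; have c0 : {for e, continuous (@bundle_proj K X eta \o
      (fun e : total_space (whitney_sum (product_family K X k) eta) =>
        in_total (projT2 e).2 : total_space eta))}.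
      apply: continuous_comp; first exact: whitney_snd_continuous.
      exact: eta_proj_continuous.
    exact: c0.
  move=> e _.
  apply: (@add_sections_continuous _ e
    (fun e : total_space (whitney_sum (product_family K X k) eta) =>
      sub_incl (in_total (projT2 e).2 : total_space eta))
    (fun e : total_space (whitney_sum (product_family K X k) eta) =>
      (projT2 e).1 : 'rV[K]_k)).
    exact: (continuous_comp (@whitney_snd_continuous _ _ _ _ e)
      (@sub_incl_continuous _ _ _ _ _)).
  exact: (continuous_comp (@whitney_fst_continuous _ _ _ _ e)
    (@product_snd_continuous _ _ _ _)).
Qed.

(** Applying [pi] to a vanishing combination of the sections returns its coefficients. *)
Lemma independent_sections : has_independent_sections xi k.
Proof.
exists (fun l : 'I_k => s l); split=> [l|x]; first exact: cs.
apply: (introT (@freeP _ _ k [tuple s l x | l < k])) => a a0 l.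
have : pi x (comb x (\row_l a l)) = 0.
  rewrite [X in pi x X](_ : _ = 0) ?linear0 // -[RHS]a0.
  by apply: eq_bigr => l' _; rewrite mxE -tnth_nth tnth_mktuple.
by rewrite pi_comb => /rowP/(_ l); rewrite !mxE.
Qed.

End Splitting.

(** * Complex bundles *)

Section RealPlaneBundles.
Local Open Scope classical_set_scope.
Local Open Scope ring_scope.

(** The inequality at [l] is what the construction of the section of index [l] requires. *)
Lemma summand_of_rank (R : realType) (K : numFieldType) (P : real_plane R K)
    (X : topologicalType) (xi : vbundle K X) (d b k : nat) :
  normal_space X -> covering_dim_le X d -> finite_type xi ->
  (forall x, (b <= rank_at xi x)%N) ->
  (forall l, (l < k)%N -> (d < 2 * (b - l))%N) ->
  has_trivial_summand xi k /\ has_independent_sections xi k.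
Proof.
move=> nX dX [m [U [[oU cU] tU]]] rk dk.
have cb : continuous (@bundle_proj K X xi) := @bundle_proj_continuous K X xi.
have [c0 c0U] := choice (fun i => chart_of_trivial cb (oU i) (tU i)).
have cov0 : \bigcup_i cdom (c0 i) = setT.
  by rewrite -cU; apply: eq_bigcupr => i _; exact: c0U.
have zero_continuous : continuous (fun x => in_total (0 : fiber xi x)).
  move=> x; have [i _ ix] : (\bigcup_i cdom (c0 i)) x by rewrite cov0.
  apply: (@eq_continuous_at _ _ (fun y => in_total (frame (c0 i) y 0))).
    by move=> y; rewrite linear0.
  apply: (@frame_section _ _ _ X (c0 i) id (fun=> 0) x ix).
    exact: cvg_id.
  exact: cst_continuous.
have [I [c [s [cov cs ad]]]] :=
  adapted_cover cb P nX dX cov0 rk zero_continuous dk.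
have kc i x : cdom (c i) x -> (k <= crank (c i))%N.
  move=> ix; rewrite (crank_eq ix); apply: leq_trans (rk x).
  (* For positive [k], the inequality at l = k - 1 shows that b - (k - 1) is positive, that is k <=
     b. *)
  case: (posnP k) => [-> //|k0].
  have := dk k.-1; rewrite prednK // => /(_ (leqnn _)).
  by move: k0; clear; lia.
have [pi [pis cpi]] := splitting_projection cov ad kc P nX.
split; first exact: (trivial_summand cov cs ad kc pis cpi).
exact: (independent_sections cs pis).
Qed.

End RealPlaneBundles.

(** * The complex numbers as a real plane *)

Section ComplexBundles.
Local Open Scope classical_set_scope.
Local Open Scope ring_scope.
Local Open Scope complex_scope.
Context (R : realType).
Let C : numFieldType := R[i].

(** An additive map bounded by the norm is 1-Lipschitz. *)
Lemma ReIm_continuous (f : {additive C -> R}) :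
  (forall z : R[i], `|f z|%:C <= `|z|) -> continuous (f : C -> R).
Proof.
move=> fz z A /nbhs_ballP[e /= e0 eA]; apply/nbhs_ballP.
exists (e%:C : C) => /=; first by rewrite ltcR.
move=> w /= zw; apply: eA; rewrite /ball /= -raddfB -ltcR.
exact: le_lt_trans (fz _) zw.
Qed.

Lemma real_complex_continuous : continuous (fun a : R => a%:C : C).
Proof.
move=> a A /nbhs_ballP[e /= e0 eA]; apply/nbhs_ballP.
(* A positive element of [C] has zero imaginary part, so its real part serves as the radius. *)
move: e0; rewrite ltcE /= => /andP[/eqP eI eR].
exists (complex.Re e) => //= a' /= aa'; apply: eA; rewrite /ball /=.
rewrite -rmorphB normc_def /= expr0n addr0 sqrtr_sqr.
by rewrite ltcE /= -eI eqxx.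
Qed.

Lemma complex_continuous : continuous (fun z : R * R => (z.1 +i* z.2) : C).
Proof.
move=> z; apply: (@eq_continuous_at _ _
    (fun z : R * R => (z.1%:C : C) + ('i : C) * (z.2%:C : C))).
  by move=> [a b] /=; rewrite [RHS]complexE.
apply: continuousD.
  apply: (@continuous_comp _ _ _ fst (fun a : R => a%:C : C)).
    exact: cvg_fst.
  exact: real_complex_continuous.
apply: continuousM; first exact: cst_continuous.
apply: (@continuous_comp _ _ _ snd (fun a : R => a%:C : C)).
  exact: cvg_snd.
exact: real_complex_continuous.
Qed.

Lemma complex_real_plane : real_plane R C.
Proof.
apply: (@RealPlane R C (@complex.Re R) (@complex.Im R) (@Complex R)) => //.
- by move=> [? ?] [? ?].
- by move=> [? ?] [? ?].
- by move=> [].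
- apply: ReIm_continuous => z; exact: normc_ge_Re.
- apply: ReIm_continuous => -[a c] /=; simpc.
  by rewrite -sqrtr_sqr ler_wsqrtr // lerDr sqr_ge0.
- exact: complex_continuous.
Qed.

End ComplexBundles.

Lemma ltn_gamma_of_dim d : (d < 2 * (gamma_of_dim d).+1)%N.
Proof.
rewrite /gamma_of_dim; case: (leqP d 1) => [|_]; first by lia.
case: (leqP d 3) => [|_]; first by lia.
by rewrite uphalf_half; have := odd_double_half d; lia.
Qed.

Theorem theorem7p1 (R : realType) (d : nat) (X : topologicalType)
    (hX : normal_space X) (hd : covering_dim_eq X d)
    (xi : vbundle R[i]%C X) (hxi : finite_type xi)
    (b : nat) (hb : is_min_rank xi b)
    (hbg : (gamma_of_dim d + 1 <= b)%N) :
  has_trivial_summand xi (b - gamma_of_dim d) /\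
  has_independent_sections xi (b - gamma_of_dim d).
Proof.
apply: (summand_of_rank (complex_real_plane R) hX hd.1 hxi hb.2) => l lb.
(* For l < b - gamma, the difference b - l is at least gamma + 1. *)
have := ltn_gamma_of_dim d; lia.
Qed.
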